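(* Let $f$, $\varphi$, $\Phi$ satisfy the hypotheses listed in the context. Then the problem of finding $c\in\mathbb{R}$ and a continuously differentiable $q:\mathbb{R}\to\mathbb{R}$ with $$\frac{d}{dx}\bigl[\partial\Phi(q_x)\bigr]+c\,q_x+f(q)=0\ \text{ for }x\in\mathbb{R},\qquad q_x\le0\ \text{ in }\mathbb{R},\qquad\lim_{x\to-\infty}q(x)=1,\quad\lim_{x\to\infty}q(x)=-1,\qquad q(0)=\mu,$$ admits a unique solution $[q,c]$. This solution satisfies also $q_x\in L^1(\mathbb{R})\cap L^\infty(\mathbb{R})$, $q_x(x)<0$ for every $x\in\mathbb{R}$ such that $-1<q(x)<1$, and $$c=\Bigl(\int_{-\infty}^\infty|q_x|^2\,dx\Bigr)^{-1}\int_{-1}^1f(s)\,ds\ \ge0 .$$ In particular, $c>0$ if and only if $F(1)=\int_{-1}^1f(s)\,ds>0$.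
   Context: Hypotheses on $f$: $f:\mathbb{R}\to\mathbb{R}$ is Lipschitz continuous and there is $\mu\in(-1,1)$ with $f(-1)=f(\mu)=f(1)=0$, $f<0$ on $(-1,\mu)$, $f>0$ on $(\mu,1)$. With $F(r)=\int_{-1}^rf(s)\,ds$ for $-1\le r\le1$, one assumes $F(1)-F(r)=\int_r^1f(s)\,ds>0$ for all $-1<r<1$. Hypotheses on $\Phi$ (one space dimension): $\Phi(z)=\varphi(|z|)$ for $z\in\mathbb{R}$, $\Phi\in C^1(\mathbb{R})\cap C^2(\mathbb{R}\setminus\{0\})$, $\varphi\in C^1([0,\infty))\cap C^2((0,\infty))$, $\varphi(0)=\varphi'(0)=0$, and for all $z>0$: $\varphi'(z)>0$ and $\Lambda_1\le z\varphi''(z)/\varphi'(z)\le\Lambda_2$ with positive constants $\Lambda_1,\Lambda_2$. Moreover there is $\omega\in C([0,\infty))$, $\omega(0)=0$, with $|\varphi''(s)-\varphi''(y)|\le\omega(|s-y|/y)\,\varphi''(y)$ for all $s,y>0$ with $|s-y|<y/2$. Notation: $\partial\Phi=\Phi'$, $q_x=dq/dx$. The equation is understood with $x\mapsto\partial\Phi(q_x(x))$ differentiable. *)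

(* Defs.v *)
From mathcomp Require Import all_boot all_order all_algebra.
From mathcomp Require Import all_classical all_reals all_analysis.
Import Order.TTheory GRing.Theory Num.Theory.
Import numFieldNormedType.Exports.

Set Implicit Arguments.
Unset Strict Implicit.
Unset Printing Implicit Defensive.

Local Open Scope classical_set_scope.
Local Open Scope ring_scope.

Section Smoothness.
Variable R : realType.
Implicit Types (A D : set R) (g : R -> R) (x : R).

(* Meant for open A, where the two-sided derivative is the right notion. *)
Definition C1_on A g : Prop :=
  forall x, A x -> derivable g x 1 /\ {for x, continuous (derive1 g)}.

Definition C2_on A g : Prop := C1_on A g /\ C1_on A (derive1 g).

(* Derivative relative to a domain D that need not be open: only the values of
   g on D matter, so at an endpoint of D this is the one-sided derivative, and
   at interior points of D it coincides with derive1 g. *)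
Definition diff_quotient_in D g x : set_system R :=
  (g y - g x) / (y - x) @[y --> within D x^'].

Definition derive_in D g x : R := lim (diff_quotient_in D g x).

Definition C1_in D g : Prop :=
  (forall x, D x -> cvg (diff_quotient_in D g x)) /\
  {within D, continuous (derive_in D g)}.

End Smoothness.

Section Hypotheses.
Variable R : realType.

Definition primitive (f : R -> R) (r : R) : R :=
  \int[lebesgue_measure]_(s in `[-1, r]) f s.

Record bistable (f : R -> R) (mu : R) : Prop := {
  bistable_lipschitz : lipschitz f;
  bistable_mu : -1 < mu < 1;
  bistable_zeros : [/\ f (-1) = 0, f mu = 0 & f 1 = 0];
  bistable_neg : forall s, -1 < s < mu -> f s < 0;
  bistable_pos : forall s, mu < s < 1 -> 0 < f s;
  bistable_primitive :
    forall r, -1 < r < 1 -> 0 < primitive f 1 - primitive f r }.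

(* phi represents a function on [0, +oo[; its values on negative numbers are
   irrelevant.  On ]0, +oo[, derive1 phi and derive1 (derive1 phi)
   are phi' and phi''; phi' at 0 is one-sided, hence derive_in. *)
Record admissible_energy (phi Phi : R -> R) : Prop := {
  energy_radial : forall z, Phi z = phi `|z|;
  energy_Phi_C1 : C1_on setT Phi;
  energy_Phi_C2 : C2_on [set z | z != 0] Phi;
  energy_phi_C1 : C1_in `[0, +oo[ phi;
  energy_phi_C2 : C2_on `]0, +oo[ phi;
  energy_phi0 : phi 0 = 0;
  energy_dphi0 : derive_in `[0, +oo[ phi 0 = 0;
  energy_dphi_gt0 : forall z, 0 < z -> 0 < derive1 phi z;
  energy_elliptic : exists L1 L2 : R, [/\ 0 < L1, 0 < L2 &
    forall z, 0 < z -> L1 <= z * derive1 (derive1 phi) z / derive1 phi z <= L2];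
  energy_modulus : exists omega : R -> R,
    [/\ {within `[0, +oo[, continuous omega}, omega 0 = 0 &
      forall s y, 0 < s -> 0 < y -> `|s - y| < y / 2 ->
        `|derive1 (derive1 phi) s - derive1 (derive1 phi) y|
          <= omega (`|s - y| / y) * derive1 (derive1 phi) y] }.

Record travelling_wave (f Phi : R -> R) (mu : R) (q : R -> R) (c : R) : Prop := {
  wave_C1 : C1_on setT q;
  wave_flux : forall x, derivable (fun y => derive1 Phi (derive1 q y)) x 1;
  wave_eq : forall x,
    derive1 (fun y => derive1 Phi (derive1 q y)) x + c * derive1 q x + f (q x) = 0;
  wave_le0 : forall x, derive1 q x <= 0;
  wave_ninfty : q x @[x --> -oo] --> (1 : R);
  wave_pinfty : q x @[x --> +oo] --> (-1 : R);
  wave_center : q 0 = mu }.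

End Hypotheses.

(* Main.v *)
Require Import Defs.
From mathcomp Require Import all_boot all_order all_algebra.
From mathcomp Require Import all_classical all_reals all_analysis.
From mathcomp Require Import measurable_realfun ess_sup_inf.
From mathcomp Require Import ring lra.
Import Order.TTheory GRing.Theory Num.Theory.
Import numFieldNormedType.Exports.

Set Implicit Arguments.
Unset Strict Implicit.
Unset Printing Implicit Defensive.

Local Open Scope classical_set_scope.
Local Open Scope ring_scope.

(** Write [p = - q'] for the slope of a wave, [psi = Phi'], [F] for the primitive
    of [f] vanishing at [-1] and [G z = z * psi z - Phi z], the Legendre transform
    of [Phi] expressed in the slope.  Since [dG = p dpsi], the energy
    [E = G p + F q] of a wave satisfies [E' = - c p^2]; everything rests on this
    identity.

    Given a wave, [E] is monotone, and comparing it at two points at distance at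
    most one, at one of which [p] is a difference of values of [q], bounds [p]
    and shows that [p] vanishes at both infinities ([wave_slope_estimate]).  So
    [E] goes from [F 1] to [0], which gives [c >= 0], with equality exactly when
    [F 1 = 0], and, by integration, [c * int p^2 = F 1].  At a point with [p = 0]
    and [-1 < q < 1] the flux [psi p] is minimal, so [f q = 0], so [q = mu] and
    [E = F mu < 0], whereas [E] decreases to [0]: the wave is strictly decreasing
    through the intermediate values ([wave_slope_gt0]).

    The slope is then a function of the value [r] of the wave and solves
    [d psi(p) / dr = c - f r / p] on [(-1, 1)], with [p] tending to zero at both
    ends.  The right-hand side decreases with the flux where [f < 0] and increases
    with it where [f > 0].  Hence on [(-1, mu)] the profile with the larger speed
    is above, on [(mu, 1)] it is below, and at [mu] this forces equal speeds
    ([profile_compare]); equal profiles give equal waves because both waves take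
    the value [mu] at [0].

    For existence, use the unknown [w = G p], for which the equation reads
    [w' = c * h w - f] with [h] the inverse of [G], truncated to be bounded.
    As [h] is nondecreasing, for each [c >= 0] there is a greatest solution with
    [w (-1) = 0], the supremum of all subsolutions ([maxsol]).  It increases with
    [c]; let [c0] be the infimum of the speeds with [w 1 >= 0].  The limits from
    above and from below at [c0] are solutions at speed [c0] ([maxsol_lim]).  The
    first has [w 1 >= 0], hence so does the greatest solution at [c0].  The second,
    if [c0 > 0], has [w 1 <= 0], and were the greatest solution positive at [1],
    both would agree there: they agree at [mu] by the monotonicity in the flux,
    and beyond because [h] is Lipschitz away from zero.  If [c0 = 0] then
    [w 1 = - F 1 <= 0].  So [w 1 = 0] at speed [c0].  A wave is recovered from
    [p] by separation of variables, and is continued by the constants [1] and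
    [-1] if these are reached at finite points. *)

(** * Differential calculus on the line *)

(** A form of differentiability without quotients, suited to proofs by
    two-sided estimates. *)
Lemma is_derive_epsP (R : realType) (u : R -> R) (x d : R) :
  is_derive x (1 : R) u d <->
  forall e, 0 < e -> \forall y \near x, `|u y - u x - d * (y - x)| <= e * `|y - x|.
Proof.
rewrite is_derive1_caratheodory; split=> [[g [gE gc gx]] e e0|H].
  move/cvgrPdist_lt : gc => /(_ e e0); apply: filterS => y; rewrite gx => hy.
  by rewrite gE -mulrBl normrM ler_wpM2r// ltW// distrC.
exists (fun z => if z == x then d else (u z - u x) / (z - x)); split.
- move=> z; case: eqP => [->|/eqP zx]; first by rewrite !subrr mulr0.
  by rewrite divfK// subr_eq0.
- apply/cvgrPdist_le => e e0; move: (H e e0); apply: filterS => y.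
  rewrite eqxx; case: eqP => [_ _|/eqP yx hy]; first by rewrite subrr normr0 ltW.
  have yx0 : y - x != 0 by rewrite subr_eq0.
  have := hy; rewrite -ler_pdivrMr ?normr_gt0// -normfV -normrM.
  by rewrite mulrBl mulfK// distrC.
- by rewrite eqxx.
Qed.

Lemma is_derive_continuous (R : realType) (u : R -> R) (x d : R) :
  is_derive x (1 : R) u d -> {for x, continuous u}.
Proof. by move=> [du _]; apply/differentiable_continuous/derivable1_diffP. Qed.

Lemma mean_value (R : realType) (u du : R -> R) (a b : R) : a < b ->
  (forall x, a < x < b -> is_derive x (1 : R) u (du x)) ->
  (forall x, a <= x <= b -> {for x, continuous u}) ->
  exists2 c, a < c < b & u b - u a = du c * (b - a).
Proof.
move=> ab du' cu.
suff [c] : exists2 c, c \in `]a, b[ & u b - u a = du c * (b - a).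
  by rewrite in_itv/=; exists c.
apply: (MVT ab).
by apply: continuous_in_subspaceT => y /set_mem/=; rewrite in_itv/=; exact: cu.
Qed.

Lemma derive_ge0_le (R : realType) (u du : R -> R) (a b : R) : a <= b ->
  (forall x, a < x < b -> is_derive x (1 : R) u (du x)) ->
  (forall x, a <= x <= b -> {for x, continuous u}) ->
  (forall x, a < x < b -> 0 <= du x) -> u a <= u b.
Proof.
rewrite le_eqVlt => /predU1P[->//|ab] hd hc h0.
have [c cab e] := mean_value ab hd hc.
by rewrite -subr_ge0 e mulr_ge0 ?h0// subr_ge0 ltW.
Qed.

Lemma derive_le0_ge (R : realType) (u du : R -> R) (a b : R) : a <= b ->
  (forall x, a < x < b -> is_derive x (1 : R) u (du x)) ->
  (forall x, a <= x <= b -> {for x, continuous u}) ->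
  (forall x, a < x < b -> du x <= 0) -> u b <= u a.
Proof.
rewrite le_eqVlt => /predU1P[->//|ab] hd hc h0.
have [c cab e] := mean_value ab hd hc.
by rewrite -subr_le0 e mulr_le0_ge0 ?h0// subr_ge0 ltW.
Qed.

Lemma derive_gt0_lt (R : realType) (u du : R -> R) (a b : R) : a < b ->
  (forall x, a < x < b -> is_derive x (1 : R) u (du x)) ->
  (forall x, a <= x <= b -> {for x, continuous u}) ->
  (forall x, a < x < b -> 0 < du x) -> u a < u b.
Proof.
move=> ab hd hc h0.
have [c cab e] := mean_value ab hd hc.
by rewrite -subr_gt0 e mulr_gt0 ?h0// subr_gt0.
Qed.

(** By the mean value theorem, a derivative that has a limit at a point of
    continuity is also the derivative at that point. *)
Lemma is_derive_extend (R : realType) (u v : R -> R) (a : R) :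
  (\forall x \near a^', is_derive x (1 : R) u (v x)) ->
  {for a, continuous u} -> {for a, continuous v} ->
  is_derive a (1 : R) u (v a).
Proof.
move=> hd cu cv; apply/is_derive_epsP => e e0.
move/cvgrPdist_le : cv => /(_ e e0) [r /= r0 hr].
have [s /= s0 hs] := hd.
have key z : ball a (Num.min r s) z -> z != a ->
    is_derive z (1 : R) u (v z) /\ `|v z - v a| <= e.
  rewrite /ball/= lt_min => /andP[zr zs] za; split; first exact: hs.
  by rewrite distrC; exact: hr.
have cu' z : ball a (Num.min r s) z -> {for z, continuous u}.
  have [->//|za] := eqVneq z a.
  by move=> hz; have [/is_derive_continuous] := key z hz za.
exists (Num.min r s); first by rewrite /= lt_min r0 s0.
have bb (z w : R) : `|z - a| <= `|w - a| -> ball a (Num.min r s) w ->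
    ball a (Num.min r s) z.
  by rewrite /ball/= ![`|a - _|]distrC; exact: le_lt_trans.
move=> y hy; have [ya|ay|->] := ltgtP y a; last by rewrite !subrr mulr0 subr0 normr0 mulr0.
- have [||c /andP[yc ca] e'] := @mean_value _ u v _ _ ya.
  + move=> x /andP[yx xa]; apply: (proj1 (key x _ _)); last by rewrite lt_eqF.
    by apply: bb hy; rewrite !ltr0_norm ?subr_lt0//; lra.
  + move=> x /andP[yx xa]; apply: cu'; apply: bb hy.
    by rewrite ler0_norm ?subr_le0// ltr0_norm ?subr_lt0//; lra.
  have hv : `|v c - v a| <= e.
    apply: (proj2 (key c _ _)); last by rewrite lt_eqF.
    by apply: bb hy; rewrite !ltr0_norm ?subr_lt0//; lra.
  rewrite (_ : u y = u a - v c * (a - y)); last by rewrite -e'; ring.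
  rewrite (_ : _ - _ = (v c - v a) * (y - a)); last by ring.
  by rewrite normrM ler_wpM2r.
- have [||c /andP[ac cy] e'] := @mean_value _ u v _ _ ay.
  + move=> x /andP[yx xa]; apply: (proj1 (key x _ _)); last by rewrite gt_eqF.
    by apply: bb hy; rewrite !gtr0_norm ?subr_gt0//; lra.
  + move=> x /andP[yx xa]; apply: cu'; apply: bb hy.
    by rewrite ger0_norm ?subr_ge0// gtr0_norm ?subr_gt0//; lra.
  have hv : `|v c - v a| <= e.
    apply: (proj2 (key c _ _)); last by rewrite gt_eqF.
    by apply: bb hy; rewrite !gtr0_norm ?subr_gt0//; lra.
  rewrite e' (_ : _ - _ = (v c - v a) * (y - a)); last by ring.
  by rewrite normrM ler_wpM2r.
Qed.

Lemma is_derive_lt_right (R : realType) (u : R -> R) (x d b : R) :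
  is_derive x (1 : R) u d -> d < 0 -> x < b -> exists2 y, x < y < b & u y < u x.
Proof.
move=> /is_derive_epsP H d0 xb.
have [r /= r0 hr] : \forall y \near x, `|u y - u x - d * (y - x)| <= - d / 2 * `|y - x|.
  by apply: H; lra.
pose y := x + Num.min (r / 2) ((b - x) / 2).
have m0 : 0 < Num.min (r / 2) ((b - x) / 2) by rewrite lt_min !divr_gt0// subr_gt0.
have m1 : Num.min (r / 2) ((b - x) / 2) <= r / 2 by rewrite ge_min lexx.
have m2 : Num.min (r / 2) ((b - x) / 2) <= (b - x) / 2 by rewrite ge_min lexx orbT.
exists y; first by rewrite /y; apply/andP; split; lra.
have := hr y; rewrite /ball/= distrC /y [x + _]addrC addrK.
move: (Num.min _ _) m0 m1 m2 => m m0 m1 m2.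
rewrite gtr0_norm// => /(_ _)/ler_normlP[|_]; first lra.
by nra.
Qed.

(** The square smooths the corner of the negative part, which makes sign
    arguments on solutions a matter of monotonicity. *)
Lemma is_derive_min0_sqr (R : realType) (t : R) :
  is_derive t (1 : R) (fun s : R => Num.min s 0 ^+ 2) (2 * Num.min t 0).
Proof.
apply/is_derive_epsP => e e0; exists e => //= s; rewrite /ball/= distrC => hs.
apply: le_trans (_ : `|s - t| * `|s - t| <= _); last by rewrite ler_wpM2r// ltW.
rewrite -normrM [leRHS]ger0_norm -?expr2 ?sqr_ge0//.
have st (a b : R) : a <= 0 -> 0 < b -> a * b <= 0 by move=> a0 b0; rewrite mulr_le0_ge0// ltW.
have := sqr_ge0 (s - t); have := sqr_ge0 s; have := sqr_ge0 t.
clear hs e0; move=> t2 s2 st2.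
by apply/ler_normlP; case: (leP s 0) => s0; case: (leP t 0) => t0; split;
  try have := st _ _ s0 t0; try have := st _ _ t0 s0; nra.
Qed.

(** The squared negative part of [D] is nonincreasing, because [D] can only
    grow while it is negative. *)
Lemma neg_part_le (R : realType) (D dD : R -> R) (a b : R) : a <= b ->
  (forall x, a <= x <= b -> is_derive x (1 : R) D (dD x)) ->
  (forall x, a <= x <= b -> D x < 0 -> 0 <= dD x) ->
  D b < 0 -> D a <= D b.
Proof.
move=> ab hd h0 Db.
have hu x : a <= x <= b ->
    is_derive x (1 : R) (fun x => Num.min (D x) 0 ^+ 2)
      (2 * Num.min (D x) 0 * dD x).
  move=> hx; exact: (@is_derive1_comp _ (fun s => Num.min s 0 ^+ 2) _ _ _ _
    (is_derive_min0_sqr _) (hd x hx)).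
have : Num.min (D b) 0 ^+ 2 <= Num.min (D a) 0 ^+ 2.
  apply: (derive_le0_ge ab (u := fun x => Num.min (D x) 0 ^+ 2) (du := fun x => 2 * Num.min (D x) 0 * dD x)).
  - by move=> x /andP[ax xb]; apply: hu; rewrite !ltW.
  - by move=> x /hu/is_derive_continuous.
  - move=> x /andP[ax xb]; have hx : a <= x <= b by rewrite !ltW.
    have := h0 x hx; case: (leP (D x) 0); last by rewrite mulr0 mul0r.
    rewrite le_eqVlt => /predU1P[->|Dx /(_ Dx)]; first by rewrite mulr0 mul0r.
    by nra.
by case: (leP (D b) 0) => Db0; case: (leP (D a) 0) => Da0; nra.
Qed.

Lemma pos_part_le (R : realType) (D dD : R -> R) (a b : R) : a <= b ->
  (forall x, a <= x <= b -> is_derive x (1 : R) D (dD x)) ->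
  (forall x, a <= x <= b -> 0 < D x -> 0 <= dD x) ->
  0 < D a -> D a <= D b.
Proof.
move=> ab hd h0 Da.
have := @neg_part_le R (fun x => - D (- x)) (fun x => dD (- x)) (- b) (- a).
rewrite !opprK lerN2 lerN2 oppr_lt0; apply => // x hx.
- have hx' : a <= - x <= b by rewrite lerNr lerNl andbC.
  have := is_deriveN (is_derive1_comp (hd _ hx') (is_deriveNid x 1)).
  by rewrite mulrN1 opprK.
- by rewrite oppr_lt0; apply: h0; rewrite lerNr lerNl andbC.
Qed.

(** The integral is oriented by hand, as integrals over an interval whose ends
    are in the wrong order vanish. *)
Lemma antiderivative (R : realType) (D : set R) (g : R -> R) (m : R) :
  open D -> is_interval D -> D m -> (forall x, D x -> {for x, continuous g}) ->
  exists2 X : R -> R, X m = 0 & forall x, D x -> is_derive x (1 : R) X (g x).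
Proof.
move=> oD iD Dm cg.
pose J a b := \int[lebesgue_measure]_(t in `[a, b]) g t.
exists (fun r => J m r - J r m); first by rewrite subrr.
have nb x : D x -> exists a b, [/\ a < x, x < b, D a & D b].
  move=> Dx; have /nbhs_ballP[r /= r0 hr] : nbhs x D by exact: open_nbhs_nbhs.
  have r2 : 0 < r / 2 < r by lra.
  exists (x - r / 2), (x + r / 2); split.
  - by rewrite ltrBlDr ltrDl; case/andP: r2.
  - by rewrite ltrDl; case/andP: r2.
  - apply: hr; rewrite /ball/= (_ : x - (x - r / 2) = r / 2); last by ring.
    by rewrite gtr0_norm; case/andP: r2.
  - apply: hr; rewrite /ball/= (_ : x - (x + r / 2) = - (r / 2)); last by ring.
    by rewrite normrN gtr0_norm; case/andP: r2.
move=> x Dx.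
have [a1 [b1 [a1x xb1 Da1 Db1]]] := nb x Dx.
have [a2 [b2 [a2m mb2 Da2 Db2]]] := nb m Dm.
pose a := Num.min a1 a2; pose b := Num.max b1 b2.
have Da : D a by rewrite /a; case: leP.
have Db : D b by rewrite /b; case: leP.
have ax : a < x by rewrite gt_min a1x.
have am : a < m by rewrite gt_min a2m orbT.
have xb : x < b by rewrite lt_max xb1.
have mb : m < b by rewrite lt_max mb2 orbT.
have itg r : r <= b -> lebesgue_measure.-integrable `[a, r] (EFin \o g).
  move=> rb; apply: continuous_compact_integrable; first exact: segment_compact.
  apply: continuous_in_subspaceT => z /set_mem/=; rewrite in_itv/= => /andP[az zr].
  by apply: cg; apply: (iD a b) => //; rewrite az (le_trans zr).
have JB r s : a <= r -> r <= s -> s <= b -> J a s - J a r = J r s.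
  move=> ar rs sb; rewrite /J Rintegral_itvB ?bnd_simp//; last exact: itg.
  rewrite Rintegral_itv_obnd_cbnd//; apply: integrableS (itg s sb) => //.
  by move=> z /=; rewrite !in_itv/= => /andP[rz ->]; rewrite ltW// (le_lt_trans ar).
have J0 r s : s < r -> J r s = 0.
  by move=> sr; rewrite /J set_itv_ge ?Rintegral_set0// bnd_simp -ltNge.
have JJ r : J r r = 0 by rewrite /J set_itv1 Rintegral_set1.
apply: (near_eq_is_derive (f := fun r => J a r - J a m)).
  near=> r; have ar : a < r by near: r; exact: lt_nbhsr.
  have rb : r < b by near: r; exact: lt_nbhsl.
  case: (ltgtP m r) => [mr|rm|->]; last by rewrite subrr JJ subr0.
  - by rewrite (J0 _ _ mr) subr0 JB// ltW.
  - by rewrite (J0 _ _ rm) sub0r -(JB r m) ?opprB ?ltW.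
have [] := @continuous_FTC1_closed R g a x b xb (itg b (lexx _)) ax (cg _ Dx).
rewrite -/(J a) derive1E => d1 d2.
by rewrite -[g x]subr0; apply: is_deriveB.
Unshelve. all: by end_near. Qed.

(** * The flux and the energy of a slope *)

(** What the construction of waves needs of the flux [psi] and of its energy
    [G]: the increments of [G] lie between the two endpoint
    approximations of the integral of [p dpsi], and the ellipticity bound makes
    [G] grow at least linearly away from zero. *)
Record legendre_pair (R : realType) (psi G : R -> R) (lam : R) : Prop := {
  pair_flux_continuous : continuous psi;
  pair_flux0 : psi 0 = 0;
  pair_flux_odd : forall z, psi (- z) = - psi z;
  pair_flux_lt : forall x y, 0 <= x -> x < y -> psi x < psi y;
  pair_energy_continuous : continuous G;
  pair_energy0 : G 0 = 0;
  pair_energy_ge : forall x y, 0 <= x -> x <= y ->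
    x * (psi y - psi x) <= G y - G x;
  pair_energy_le : forall x y, 0 <= x -> x <= y ->
    G y - G x <= y * (psi y - psi x);
  pair_lam_gt0 : 0 < lam;
  pair_energy_coercive : forall x y, 0 <= x -> x <= y ->
    lam * psi x * (y - x) <= G y - G x }.

Lemma is_derive1P (R : realType) (u : R -> R) (x : R) :
  derivable u x 1 -> is_derive x (1 : R) u (derive1 u x).
Proof. by move=> du; rewrite derive1E; exact: derivableP. Qed.

Lemma is_derive1_val (R : realType) (u : R -> R) (x d : R) :
  is_derive x (1 : R) u d -> derive1 u x = d.
Proof. by move=> du; rewrite derive1E; exact: derive_val. Qed.

(** [Phi] is even, so its derivative is odd; away from zero
    [(z * psi z - Phi z)' = z * psi' z >= L1 * psi z] by ellipticity. *)
Lemma admissible_legendre_pair (R : realType) (phi Phi : R -> R) :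
  admissible_energy phi Phi ->
  exists lam, legendre_pair (derive1 Phi)
    (fun z => z * derive1 Phi z - Phi z) lam.
Proof.
move=> H; pose psi : R -> R := derive1 Phi; rewrite -/psi.
have [L1 [L2 [L10 L20 HL]]] := energy_elliptic H.
have dPhi (z : R) : is_derive z (1 : R) Phi (psi z).
  by apply: is_derive1P; have [] := energy_Phi_C1 H (x := z) I.
have cpsi : continuous psi by move=> z; have [] := energy_Phi_C1 H (x := z) I.
have cPhi (z : R) : {for z, continuous Phi} by exact: is_derive_continuous (dPhi z).
have odd (z : R) : psi (- z) = - psi z.
  have PhiN : Phi = Phi \o -%R.
    by apply/funext => y; rewrite /= !(energy_radial H) normrN.
  have d2 : is_derive z (1 : R) Phi (psi (- z) * -1).
    by rewrite PhiN; exact: is_derive1_comp (dPhi (- z)) (is_deriveNid z 1).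
  by have := is_derive1_val d2; rewrite -/psi => ->; rewrite mulrN1 opprK.
have psi0 : psi 0 = 0 by have := odd 0; rewrite oppr0; lra.
have psiE (z : R) : 0 < z -> psi z = derive1 phi z.
  move=> z0; apply: is_derive1_val; apply: (near_eq_is_derive (f := phi)).
    near=> y; rewrite (energy_radial H) gtr0_norm//.
    by near: y; exact: lt_nbhsr.
  apply: is_derive1P; have [hz _] := energy_phi_C2 H.
  by have [] := hz z; rewrite /= ?in_itv/= ?andbT.
pose psi' : R -> R := derive1 (derive1 phi).
have dpsi (z : R) : 0 < z -> is_derive z (1 : R) psi (psi' z).
  move=> z0; apply: (near_eq_is_derive (f := derive1 phi)).
    near=> y; rewrite psiE//.
    by near: y; exact: lt_nbhsr.
  apply: is_derive1P; have [_ hz] := energy_phi_C2 H.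
  by have [] := hz z; rewrite /= ?in_itv/= ?andbT.
have psi_gt0 (z : R) : 0 < z -> 0 < psi z.
  by move=> z0; rewrite psiE//; exact: (energy_dphi_gt0 H).
have ell (z : R) : 0 < z -> L1 * psi z <= z * psi' z.
  move=> z0; have /andP[+ _] := HL z z0; rewrite -/psi' -psiE//.
  by rewrite ler_pdivlMr// psi_gt0.
have psi'_gt0 (z : R) : 0 < z -> 0 < psi' z.
  move=> z0; have := lt_le_trans (mulr_gt0 L10 (psi_gt0 z z0)) (ell z z0).
  by rewrite pmulr_rgt0.
have psi_lt (x y : R) : 0 <= x -> x < y -> psi x < psi y.
  move=> x0 xy; apply: (derive_gt0_lt xy (du := psi')).
  - by move=> z /andP[xz _]; apply: dpsi; exact: le_lt_trans xz.
  - by move=> z _; exact: cpsi.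
  - by move=> z /andP[xz _]; apply: psi'_gt0; exact: le_lt_trans xz.
have psi_le (x y : R) : 0 <= x -> x <= y -> psi x <= psi y.
  by move=> x0; rewrite le_eqVlt => /predU1P[->//|/(psi_lt _ _ x0)/ltW].
pose G (z : R) := z * psi z - Phi z.
have cG : continuous G.
  move=> z; apply: cvgB; last exact: cPhi.
  by apply: cvgM; [exact: cvg_id|exact: cpsi].
have PhiB (x y : R) : 0 <= x -> x < y ->
    exists2 c, psi x <= psi c <= psi y & Phi y - Phi x = psi c * (y - x).
  move=> x0 xy; have [c /andP[xc cy] e] :=
    @mean_value _ Phi psi _ _ xy (fun z _ => dPhi z) (fun z _ => cPhi z).
  exists c => //; rewrite !psi_le// ?ltW//; exact: le_lt_trans xc.
exists L1; split => //.
- rewrite psi0 mulr0 sub0r (energy_radial H) normr0 (energy_phi0 H).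
  by rewrite oppr0.
- move=> x y x0; rewrite le_eqVlt => /predU1P[->|xy]; first by rewrite !subrr mulr0.
  have [c /andP[c1 c2] e] := PhiB x y x0 xy.
  have : psi c * (y - x) <= psi y * (y - x) by rewrite ler_wpM2r// subr_ge0 ltW.
  by rewrite -e; lra.
- move=> x y x0; rewrite le_eqVlt => /predU1P[->|xy]; first by rewrite !subrr mulr0.
  have [c /andP[c1 c2] e] := PhiB x y x0 xy.
  have : psi x * (y - x) <= psi c * (y - x) by rewrite ler_wpM2r// subr_ge0 ltW.
  by rewrite -e; lra.
- move=> x y x0; rewrite le_eqVlt => /predU1P[->|xy]; first by rewrite !subrr mulr0.
  have hG z : x < z < y -> is_derive z (1 : R) G (z * psi' z).
    move=> /andP[xz zy]; have z0 : 0 < z by exact: le_lt_trans xz.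
    have := is_deriveB (is_deriveM (is_derive_id z (1 : R)) (dpsi z z0)) (dPhi z).
    rewrite /= (_ : _ - _ = z * psi' z)//.
    by rewrite /GRing.scale/= mulr1; ring.
  have [c /andP[xc cy] e] := mean_value xy hG (fun z _ => cG z).
  rewrite -/(G y) -/(G x) e; apply: ler_wpM2r; first by rewrite subr_ge0 ltW.
  have c0 : 0 < c by exact: le_lt_trans xc.
  by apply: le_trans (ell c c0); rewrite ler_pM2l// psi_le// ltW.
Unshelve. all: by end_near. Qed.

Section Legendre.
Variables (R : realType) (psi G : R -> R) (lam : R).
Hypothesis H : legendre_pair psi G lam.

Lemma pair_flux_le x y : 0 <= x -> x <= y -> psi x <= psi y.
Proof.
move=> x0; rewrite le_eqVlt => /predU1P[->//|xy].
by apply/ltW; exact: (pair_flux_lt H).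
Qed.

Lemma pair_flux_gt0 x : 0 < x -> 0 < psi x.
Proof. by move=> x0; have := pair_flux_lt H (lexx 0) x0; rewrite (pair_flux0 H). Qed.

Lemma pair_flux_ge0 x : 0 <= x -> 0 <= psi x.
Proof. by move=> x0; have := pair_flux_le (lexx 0) x0; rewrite (pair_flux0 H). Qed.

Lemma pair_energy_mono_le x y : 0 <= x -> x <= y -> G x <= G y.
Proof.
move=> x0 xy; rewrite -subr_ge0; apply: le_trans (pair_energy_ge H x0 xy).
by rewrite mulr_ge0// subr_ge0 pair_flux_le.
Qed.

Lemma pair_energy_lt x y : 0 <= x -> x < y -> G x < G y.
Proof.
move=> x0 xy; have [m xm my] : exists2 m, x < m & m < y by exists ((x + y) / 2); lra.
have m0 : 0 < m by exact: le_lt_trans xm.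
apply: (@le_lt_trans _ _ (G m)); first by rewrite pair_energy_mono_le// ltW.
rewrite -subr_gt0; apply: lt_le_trans (pair_energy_ge H (ltW m0) (ltW my)).
by rewrite mulr_gt0// subr_gt0 (pair_flux_lt H)// ltW.
Qed.

Lemma pair_energy_gt0 x : 0 < x -> 0 < G x.
Proof. by move=> x0; have := pair_energy_lt (lexx 0) x0; rewrite (pair_energy0 H). Qed.

Lemma pair_energy_ge0 x : 0 <= x -> 0 <= G x.
Proof. by move=> x0; have := pair_energy_mono_le (lexx 0) x0; rewrite (pair_energy0 H). Qed.

Lemma pair_energy_ltE x y : 0 <= x -> 0 <= y -> (G x < G y) = (x < y).
Proof.
move=> x0 y0; case: (ltP x y) => [xy|yx]; first by rewrite pair_energy_lt.
by apply/negbTE; rewrite -leNgt pair_energy_mono_le.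
Qed.

Lemma pair_energy_leE x y : 0 <= x -> 0 <= y -> (G x <= G y) = (x <= y).
Proof. by move=> x0 y0; rewrite !leNgt pair_energy_ltE. Qed.

Lemma pair_energy_inj x y : 0 <= x -> 0 <= y -> G x = G y -> x = y.
Proof.
move=> x0 y0 e; apply/eqP; rewrite eq_le.
by rewrite -(pair_energy_leE x0 y0) -(pair_energy_leE y0 x0) e lexx.
Qed.

Lemma pair_flux_ltE x y : 0 <= x -> 0 <= y -> (psi x < psi y) = (x < y).
Proof.
move=> x0 y0; case: (ltP x y) => [xy|yx]; first by rewrite (pair_flux_lt H).
by apply/negbTE; rewrite -leNgt pair_flux_le.
Qed.

Lemma pair_energy_unbounded w : 0 <= w -> exists2 p, 0 <= p & w < G p.
Proof.
move=> w0; have c0 : 0 < lam * psi 1 by rewrite mulr_gt0 ?pair_flux_gt0// (pair_lam_gt0 H).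
have d0 : 0 <= (w + 1) / (lam * psi 1) by rewrite divr_ge0// ?ltW// ltr_wpDl.
exists (1 + (w + 1) / (lam * psi 1)); first by rewrite addr_ge0.
have := @pair_energy_coercive _ _ _ _ H 1 (1 + (w + 1) / (lam * psi 1)) ler01.
rewrite lerDl => /(_ d0); rewrite [X in _ * X]addrC addKr.
rewrite mulrCA mulfV ?gt_eqF// mulr1.
by have := pair_energy_ge0 ler01; lra.
Qed.

(** As a function of the flux, the energy is the Legendre transform of the
    primitive of [psi]; its derivative with respect to the flux is therefore the
    slope, even where the slope itself is not differentiable. *)
Lemma is_derive_energy (p : R -> R) (x d : R) :
  (forall y, 0 <= p y) -> {for x, continuous p} ->
  is_derive x (1 : R) (psi \o p) d -> is_derive x (1 : R) (G \o p) (p x * d).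
Proof.
move=> p0 cp /is_derive_epsP hd; apply/is_derive_epsP => e e0.
pose k := `|d| + 1 + p x.
have k0 : 0 < k by rewrite /k; have := p0 x; have := normr_ge0 d; lra.
(* The increment of the slope and the linearization error of the flux (relative
   to [|y - x|]) are taken below [s], which leaves a total error of at most
   [s * k * |y - x|]. *)
pose s := Num.min 1 (e / k).
have s0 : 0 < s by rewrite lt_min ltr01 divr_gt0.
have sk : s * k <= e by rewrite -ler_pdivlMr// ge_min lexx orbT.
have s1 : s <= 1 by rewrite ge_min lexx.
near=> y.
have h1 : `|psi (p y) - psi (p x) - d * (y - x)| <= s * `|y - x|.
  by near: y; exact: hd.
have h2 : `|p x - p y| <= s.
  by near: y; move/cvgrPdist_le : cp; exact.
have hG : `|G (p y) - G (p x) - p x * (psi (p y) - psi (p x))| <=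
    `|p x - p y| * `|psi (p y) - psi (p x)|.
  rewrite -normrM; have [xy|/ltW yx] := leP (p x) (p y).
  - have := pair_energy_ge H (p0 x) xy; have := pair_energy_le H (p0 x) xy => a b.
    rewrite [leLHS]ger0_norm; last by lra.
    by rewrite -normrN; apply: le_trans (ler_norm _); lra.
  - have := pair_energy_ge H (p0 y) yx; have := pair_energy_le H (p0 y) yx => a b.
    rewrite [leLHS]ger0_norm; last by lra.
    by rewrite -normrN; apply: le_trans (ler_norm _); lra.
have h3 : `|psi (p y) - psi (p x)| <= (`|d| + 1) * `|y - x|.
  rewrite (_ : psi (p y) - psi (p x) =
    psi (p y) - psi (p x) - d * (y - x) + d * (y - x)); last by ring.
  apply: le_trans (ler_normD _ _) _; rewrite normrM.
  have : s * `|y - x| <= 1 * `|y - x| by rewrite ler_wpM2r.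
  by lra.
rewrite /= (_ : _ - _ - _ = (G (p y) - G (p x) - p x * (psi (p y) - psi (p x)))
  + p x * (psi (p y) - psi (p x) - d * (y - x))); last by ring.
apply: le_trans (ler_normD _ _) _; rewrite normrM (ger0_norm (p0 x)).
have : `|p x - p y| * `|psi (p y) - psi (p x)| <= s * ((`|d| + 1) * `|y - x|).
  exact: ler_pM.
have : p x * `|psi (p y) - psi (p x) - d * (y - x)| <= p x * (s * `|y - x|).
  by rewrite ler_wpM2l.
have : s * k * `|y - x| <= e * `|y - x| by rewrite ler_wpM2r.
by rewrite /k; lra.
Unshelve. all: by end_near. Qed.

End Legendre.

(** * Greatest solutions of the integrated profile equation *)

Definition prim (R : realType) (g : R -> R) : R -> R :=
  xget (fun=> 0) [set X : R -> R |
    X (- 1) = 0 /\ forall x, is_derive x (1 : R) X (g x)].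

Lemma primP (R : realType) (g : R -> R) : continuous g ->
  prim g (- 1) = 0 /\ forall x, is_derive x (1 : R) (prim g) (g x).
Proof.
move=> cg; rewrite /prim; case: xgetP => [X _ //|H]; exfalso.
have [||||X X0 dX] := @antiderivative R setT g (- 1).
- exact: openT.
- by [].
- by [].
- by move=> x _; exact: cg.
by apply: (H X); split => // x; exact: dX.
Qed.

(** The function [D x * expR (- k * x)] is nonincreasing. *)
Lemma gronwall_le0 (R : realType) (D dD : R -> R) (k a b : R) : a <= b ->
  (forall x, a < x < b -> is_derive x (1 : R) D (dD x)) ->
  (forall x, a <= x <= b -> {for x, continuous D}) ->
  (forall x, a < x < b -> dD x <= k * D x) -> D a <= 0 -> D b <= 0.
Proof.
move=> ab hd hc hk Da.
pose E (x : R) := expR (- k * x).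
have dE (x : R) : is_derive x (1 : R) E (- k * E x).
  rewrite mulrC; apply: is_derive1_comp.
  have := is_deriveM (is_derive_cst (- k : R) x (1 : R)) (is_derive_id x (1 : R)).
  by rewrite /GRing.scale/= mulr1 mulr0 addr0.
have hu x : a < x < b -> is_derive x (1 : R) (fun x => D x * E x)
    (E x * (dD x - k * D x)).
  move=> hx; have := is_deriveM (hd x hx) (dE x).
  by rewrite /GRing.scale/= (_ : _ + _ = E x * (dD x - k * D x))//; ring.
have E0 x : 0 < E x by exact: expR_gt0.
suff : D b * E b <= D a * E a.
  move=> h; rewrite -(pmulr_lle0 _ (E0 b)); apply: le_trans h _.
  by rewrite pmulr_lle0.
apply: (derive_le0_ge ab hu).
- move=> x hx; apply: cvgM; first exact: hc.
  exact: is_derive_continuous (dE x).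
- by move=> x hx; rewrite pmulr_rle0// subr_le0; exact: hk.
Qed.

(** Nondecreasing and [M]-Lipschitz.  This class is stable under pointwise
    suprema and limits, and the integral operator below takes its values in it. *)
Definition lip_nondecreasing (R : realType) (M : R) (v : R -> R) :=
  forall x y, x <= y -> v x <= v y <= v x + M * (y - x).

Lemma near_dist_le (R : realType) (x d : R) : 0 < d ->
  \forall y \near x, `|x - y| <= d.
Proof. by move=> d0; exists d => //= y /ltW. Qed.

Lemma lip_nondecreasing_dist (R : realType) (M : R) (v : R -> R) x y :
  lip_nondecreasing M v -> `|v x - v y| <= (`|M| + 1) * `|x - y|.
Proof.
move=> sv; wlog xy : x y / x <= y => [H|].
  by have [/H//|/ltW/H] := leP x y; rewrite distrC (distrC y).
have /andP[h1 h2] := sv _ _ xy; rewrite distrC (distrC x).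
rewrite [leLHS]ger0_norm ?subr_ge0// [X in _ * X]ger0_norm ?subr_ge0//.
have : M * (y - x) <= `|M| * (y - x) by rewrite ler_wpM2r ?ler_norm ?subr_ge0.
by lra.
Qed.

Lemma lip_nondecreasing_continuous (R : realType) (M : R) (v : R -> R) :
  lip_nondecreasing M v -> continuous v.
Proof.
move=> sv x; apply/cvgrPdist_le => e e0.
have M1 : 0 < `|M| + 1 by rewrite ltr_wpDl.
near=> y; apply: le_trans (lip_nondecreasing_dist _ _ sv) _.
rewrite mulrC -ler_pdivlMr//; near: y; apply: near_dist_le.
by rewrite divr_gt0.
Unshelve. all: by end_near. Qed.

Section Shooting.
Variables (R : realType) (F h : R -> R) (N : R).
Hypothesis cF : continuous F.
Hypothesis ch : continuous h.
Hypothesis h_le : {homo h : x y / x <= y}.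
Hypothesis h_ge0 : forall w, 0 <= h w.
Hypothesis h_leN : forall w, h w <= N.
Implicit Types (u v U : R -> R) (c k r x d : R).

(** For the integrated profile [Y = w + F] the equation [w' = c * h w - f],
    [w (-1) = 0] becomes the fixed-point equation [Y = c * primitive_map Y]. *)
Definition primitive_map (v : R -> R) : R -> R := prim (fun s => h (v s - F s)).

Lemma primitive_mapP v : continuous v -> primitive_map v (- 1) = 0 /\
  forall x, is_derive x (1 : R) (primitive_map v) (h (v x - F x)).
Proof.
move=> cv; apply: primP => x; apply: (@cvg_comp _ _ _ (fun s => v s - F s) h).
  by apply: cvgB; [exact: cv|exact: cF].
exact: ch.
Qed.

Lemma is_deriveMl (u : R -> R) (k x d : R) :
  is_derive x (1 : R) u d -> is_derive x (1 : R) (fun y => k * u y) (k * d).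
Proof.
move=> du; have := is_deriveM (is_derive_cst (k : R) x (1 : R)) du.
by rewrite /GRing.scale/= mulr0 addr0.
Qed.

Lemma primitive_map_lip c v : 0 <= c -> continuous v ->
  lip_nondecreasing (c * N) (fun r => c * primitive_map v r).
Proof.
move=> c0 cv x y xy; have [_ dT] := primitive_mapP cv.
have dT' r := is_deriveMl c (dT r).
have cT r := is_derive_continuous (dT' r).
apply/andP; split.
  apply: (derive_ge0_le xy (fun r _ => dT' r) (fun r _ => cT r)) => r _.
  by rewrite mulr_ge0.
have dl (r : R) : is_derive r (1 : R) (fun r => c * primitive_map v r - c * N * r)
    (c * h (v r - F r) - c * N).
  have := is_deriveB (dT' r) (is_deriveMl (c * N) (is_derive_id r (1 : R))).
  by rewrite mulr1.
have := derive_le0_ge xy (fun r _ => dl r) (fun r _ => is_derive_continuous (dl r)).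
suff hh : forall r, x < r < y -> c * h (v r - F r) - c * N <= 0.
  by move/(_ hh); lra.
by move=> r _; rewrite subr_le0 ler_wpM2l.
Qed.

Lemma primitive_map_le u v : continuous u -> continuous v ->
  (forall r, -1 <= r <= 1 -> u r <= v r) ->
  forall r, -1 <= r <= 1 -> primitive_map u r <= primitive_map v r.
Proof.
move=> cu cv uv r /andP[r0 r1].
have [u0 du] := primitive_mapP cu; have [v0 dv] := primitive_mapP cv.
have dB s := is_deriveB (dv s) (du s).
have := derive_ge0_le r0 (fun s _ => dB s) (fun s _ => is_derive_continuous (dB s)).
rewrite /GRing.add/= /GRing.opp/= -!/(_ - _) u0 v0 subr0 => H.
rewrite -subr_ge0; apply: H => s /andP[s0 s1].
rewrite subr_ge0 h_le// lerB// uv// (ltW s0)/=.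
exact: le_trans (ltW s1) r1.
Qed.

Lemma primitive_map_ge0 v : continuous v ->
  forall r, -1 <= r -> 0 <= primitive_map v r.
Proof.
move=> cv r r0; have [v0 dv] := primitive_mapP cv.
rewrite -v0; apply: (derive_ge0_le r0 (fun s _ => dv s)) => // s _.
exact: is_derive_continuous (dv s).
Qed.

Definition subsol c : set (R -> R) :=
  [set v | lip_nondecreasing (c * N) v /\
    forall r, -1 <= r <= 1 -> v r <= c * primitive_map v r].

(** Since the operator is monotone, the supremum of the subsolutions is its
    greatest fixed point, as in the theorem of Knaster and Tarski. *)
Definition maxsol c (r : R) : R := sup [set v r | v in subsol c].

Lemma N_ge0 : 0 <= N.
Proof. exact: le_trans (h_ge0 0) (h_leN 0). Qed.

Lemma subsol0 c : 0 <= c -> subsol c (fun=> 0).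
Proof.
move=> c0; split=> [x y xy|r /andP[r0 _]].
  by rewrite lexx add0r !mulr_ge0 ?N_ge0// subr_ge0.
by rewrite mulr_ge0// primitive_map_ge0//; exact: cst_continuous.
Qed.

Lemma subsol_has_sup c r : 0 <= c -> has_sup [set v r | v in subsol c].
Proof.
move=> c0; split; first by exists 0, (fun=> 0); first exact: subsol0.
exists (c * N * `|r + 1|) => _ [v [sv vT] <-].
have v1 : v (- 1) <= 0.
  have := vT (- 1); rewrite lexx (_ : _ <= _ = true); last by lra.
  by have [-> _] := primitive_mapP (lip_nondecreasing_continuous sv); rewrite mulr0; apply.
have B0 : 0 <= c * N * `|r + 1| by rewrite !mulr_ge0 ?N_ge0.
have [r0|/ltW r0] := leP (- 1) r.
- have /andP[_] := sv _ _ r0; rewrite opprK ger0_norm; last by lra.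
  by lra.
- have /andP[h1 _] := sv _ _ r0.
  by rewrite (le_trans h1)// (le_trans v1).
Qed.

Lemma maxsol_ub c v r : 0 <= c -> subsol c v -> v r <= maxsol c r.
Proof.
move=> c0 Sv; apply: sup_upper_bound; first exact: subsol_has_sup.
by exists v.
Qed.

Lemma maxsol_le_ub c r b : 0 <= c -> (forall v, subsol c v -> v r <= b) ->
  maxsol c r <= b.
Proof.
move=> c0 H; apply: ge_sup; first by have [] := subsol_has_sup r c0.
by move=> _ [v Sv <-]; exact: H.
Qed.

Lemma maxsol_lip c : 0 <= c -> lip_nondecreasing (c * N) (maxsol c).
Proof.
move=> c0 x y xy; apply/andP; split; apply: maxsol_le_ub => // v Sv.
- apply: le_trans (maxsol_ub y c0 Sv).
  by have [sv _] := Sv; have /andP[] := sv _ _ xy.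
- have [sv _] := Sv; have /andP[_ h1] := sv _ _ xy.
  by rewrite (le_trans h1)// lerD2r; exact: maxsol_ub.
Qed.

Lemma maxsol_fix c r : 0 <= c -> -1 <= r <= 1 ->
  maxsol c r = c * primitive_map (maxsol c) r.
Proof.
move=> c0; have cm := lip_nondecreasing_continuous (maxsol_lip c0).
have le1 s : -1 <= s <= 1 -> maxsol c s <= c * primitive_map (maxsol c) s.
  move=> hs; apply: maxsol_le_ub => // v Sv; have [sv vT] := Sv.
  rewrite (le_trans (vT s hs))// ler_wpM2l// primitive_map_le//.
    exact: lip_nondecreasing_continuous sv.
  by move=> t _; exact: maxsol_ub.
move=> hr; apply/eqP; rewrite eq_le le1//=.
have sT := primitive_map_lip c0 cm.
apply: (@maxsol_ub c (fun s => c * primitive_map (maxsol c) s)) => //; split => //.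
move=> s hs; rewrite ler_wpM2l// primitive_map_le//.
exact: lip_nondecreasing_continuous sT.
Qed.

Lemma maxsol_max c v : 0 <= c -> continuous v ->
  (forall r, -1 <= r <= 1 -> v r <= c * primitive_map v r) ->
  forall r, -1 <= r <= 1 -> v r <= maxsol c r.
Proof.
move=> c0 cv vT r hr; rewrite (le_trans (vT r hr))//.
have sT := primitive_map_lip c0 cv.
apply: (@maxsol_ub c (fun s => c * primitive_map v s)) => //; split => //.
move=> s hs; rewrite ler_wpM2l// primitive_map_le//.
exact: lip_nondecreasing_continuous sT.
Qed.

Lemma maxsol_le c c' r : 0 <= c -> c <= c' -> maxsol c r <= maxsol c' r.
Proof.
move=> c0 cc'; have c'0 := le_trans c0 cc'.
apply: maxsol_le_ub => // v [sv vT]; apply: maxsol_ub => //; split.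
- move=> x y xy; have /andP[-> h1] := sv _ _ xy.
  rewrite /= (le_trans h1)// lerD2l ler_wpM2r ?subr_ge0//.
  by rewrite ler_wpM2r// N_ge0.
- move=> s hs; rewrite (le_trans (vT s hs))// ler_wpM2r// primitive_map_ge0//.
    exact: lip_nondecreasing_continuous sv.
  by case/andP: hs.
Qed.

(** Pointwise convergence of equi-Lipschitz functions is locally uniform, hence
    uniform on the segment by compactness, so that the integrals converge. *)
Lemma maxsol_lim (FF : set_system R) (PF : ProperFilter FF) (c0 C0 : R)
    (U : R -> R) :
  (\forall c \near FF, 0 <= c <= C0) -> c @[c --> FF] --> c0 ->
  (forall r, maxsol c r @[c --> FF] --> U r) ->
  lip_nondecreasing (C0 * N) U /\ forall r, -1 <= r <= 1 -> U r = c0 * primitive_map U r.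
Proof.
move=> hC hc hU.
have sl : \forall c \near FF, lip_nondecreasing (C0 * N) (maxsol c).
  near=> c; have /andP[c0' cC] : 0 <= c <= C0 by near: c.
  move=> x y xy; have /andP[-> h1] := maxsol_lip c0' xy.
  rewrite /= (le_trans h1)// lerD2l ler_wpM2r ?subr_ge0//.
  by rewrite ler_wpM2r// N_ge0.
have sU : lip_nondecreasing (C0 * N) U.
  move=> x y xy; apply/andP; split.
    apply: ler_cvg_to (hU x) (hU y) _.
    by near=> c; have /(_ _ _ xy)/andP[] : lip_nondecreasing (C0 * N) (maxsol c) by near: c.
  apply: ler_cvg_to (hU y) (cvgD (hU x) (cvg_cst _)) _.
  by near=> c; have /(_ _ _ xy)/andP[] : lip_nondecreasing (C0 * N) (maxsol c) by near: c.
split => //.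
have cU := lip_nondecreasing_continuous sU.
have unif e : 0 < e -> \forall c \near FF, forall s, `[-1, 1]%classic s ->
    `|c * h (maxsol c s - F s) - c0 * h (U s - F s)| <= e.
  move=> e0.
  have /compact_near_coveringP cpt := @segment_compact R (- 1) 1.
  have := cpt R FF (fun c s =>
    `|c * h (maxsol c s - F s) - c0 * h (U s - F s)| <= e) _; apply.
  move=> x _.
  have cv1 : (fun p : R * R => maxsol p.2 p.1) @ filter_prod (nbhs x) FF --> U x.
    apply/cvgrPdist_le => d d0.
    have d2 : 0 < d / 2 by rewrite divr_gt0.
    have h1 : \forall p \near filter_prod (nbhs x) FF, `|U x - maxsol p.2 x| <= d / 2.
      have : \forall c \near FF, `|U x - maxsol c x| <= d / 2.
        by move/cvgrPdist_le : (hU x) => /(_ _ d2).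
      by apply: (cvg_snd (F := nbhs x)).
    have K1 : 0 < `|C0 * N| + 1 by rewrite ltr_wpDl.
    have h2 : \forall p \near filter_prod (nbhs x) FF,
        `|x - p.1| <= d / 2 / (`|C0 * N| + 1).
      have : \forall y \near x, `|x - y| <= d / 2 / (`|C0 * N| + 1).
        by apply: near_dist_le; rewrite divr_gt0.
      by apply: (cvg_fst (G := FF)).
    have h3 : \forall p \near filter_prod (nbhs x) FF, lip_nondecreasing (C0 * N) (maxsol p.2).
      exact: (cvg_snd (F := nbhs x)) sl.
    near=> p.
    have k1 : `|U x - maxsol p.2 x| <= d / 2 by near: p.
    have k2 : `|x - p.1| * (`|C0 * N| + 1) <= d / 2.
      by rewrite -ler_pdivlMr//; near: p.
    have k3 : lip_nondecreasing (C0 * N) (maxsol p.2) by near: p.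
    have h4 : `|maxsol p.2 x - maxsol p.2 p.1| <= d / 2.
      by apply: le_trans (lip_nondecreasing_dist _ _ k3) _; rewrite mulrC.
    by have := ler_distD (maxsol p.2 x) (U x) (maxsol p.2 p.1); lra.
  have cp2 : (fun p : R * R => p.2) @ filter_prod (nbhs x) FF --> c0.
    exact: cvg_trans (cvg_snd (F := nbhs x)) hc.
  have cp1 : (fun p : R * R => p.1) @ filter_prod (nbhs x) FF --> x.
    exact: cvg_fst.
  have cF1 : (fun p : R * R => F p.1) @ filter_prod (nbhs x) FF --> F x.
    by apply: cvg_comp cp1 _; exact: cF.
  have cU1 : (fun p : R * R => U p.1) @ filter_prod (nbhs x) FF --> U x.
    by apply: cvg_comp cp1 _; exact: cU.
  have cv2 : (fun p : R * R => p.2 * h (maxsol p.2 p.1 - F p.1)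
      - c0 * h (U p.1 - F p.1)) @ filter_prod (nbhs x) FF -->
      c0 * h (U x - F x) - c0 * h (U x - F x).
    apply: cvgB; apply: cvgM => //.
    - apply: (@cvg_comp _ _ _ (fun p => maxsol p.2 p.1 - F p.1) h); last exact: ch.
      exact: cvgB.
    - exact: cvg_cst.
    - apply: (@cvg_comp _ _ _ (fun p => U p.1 - F p.1) h); last exact: ch.
      exact: cvgB.
  move: cv2; rewrite subrr => /cvgr0Pnorm_le/(_ e e0).
  exact.
move=> r hr; have /andP[r0 r1] := hr.
have [U0 dU] := primitive_mapP cU.
have key e : 0 < e -> `|U r - c0 * primitive_map U r| <= e.
  move=> e0.
  have cv : `|maxsol c r - c0 * primitive_map U r| @[c --> FF] -->
      `|U r - c0 * primitive_map U r|.
    by apply: cvg_norm; apply: cvgB; [exact: hU|exact: cvg_cst].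
  apply: ler_cvg_to cv (cvg_cst e) _; near=> c.
  have /andP[cc0 cC] : 0 <= c <= C0 by near: c.
  have hs : forall s, `[-1, 1]%classic s ->
      `|c * h (maxsol c s - F s) - c0 * h (U s - F s)| <= e / 2.
    by near: c; apply: unif; rewrite divr_gt0.
  rewrite maxsol_fix//.
  have cm := lip_nondecreasing_continuous (maxsol_lip cc0).
  have [m0 dm] := primitive_mapP cm.
  have dB s := is_deriveB (is_deriveMl c (dm s)) (is_deriveMl c0 (dU s)).
  move: r0; rewrite le_eqVlt => /predU1P[<-|r0].
    by rewrite m0 U0 !mulr0 subrr normr0 ltW.
  have [x /andP[x0 x1]] := mean_value r0 (fun s _ => dB s)
    (fun s _ => is_derive_continuous (dB s)).
  rewrite /GRing.add/= /GRing.opp/= -!/(_ - _) m0 U0 !mulr0 subrr subr0 => ->.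
  rewrite normrM (ger0_norm (_ : 0 <= r - -1)); last by lra.
  have := hs x; rewrite /= in_itv/= => /(_ _); rewrite (ltW x0) (ltW (lt_le_trans x1 r1)) => /(_ isT).
  set A := `| _ |; have : 0 <= A by exact: normr_ge0.
  by move: A => A A0 hA; nra.
apply/eqP; rewrite -subr_eq0 -normr_le0; apply/ler_addgt0Pl => e e0.
by rewrite addr0; exact: key.
Unshelve. all: by end_near. Qed.

End Shooting.

(** * Shooting in the speed *)

Record profile (R : realType) (f h w : R -> R) (c : R) : Prop := {
  profile_continuous : continuous w;
  profile_left : w (- 1) = 0;
  profile_right : w 1 = 0;
  profile_gt0 : forall r : R, -1 < r < 1 -> 0 < w r;
  profile_ode : forall r : R, -1 < r < 1 ->
    is_derive r (1 : R) w (c * h (w r) - f r) }.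

Section Connection.
Variables (R : realType) (f F h K : R -> R) (N mu : R).
Hypothesis dF : forall r : R, is_derive r (1 : R) F (f r).
Hypothesis F_left : F (- 1) = 0.
Hypothesis F_right : 0 <= F 1.
Hypothesis mu_itv : -1 < mu < 1.
Hypothesis f_lt0 : forall r : R, -1 < r < mu -> f r < 0.
Hypothesis f_gt0 : forall r : R, mu < r < 1 -> 0 < f r.
Hypothesis ch : continuous h.
Hypothesis h_le : {homo h : x y / x <= y}.
Hypothesis h0 : forall w : R, w <= 0 -> h w = 0.
Hypothesis h_gt0 : forall w : R, 0 < w -> 0 < h w.
Hypothesis h_leN : forall w : R, h w <= N.
Hypothesis h_lip : forall m, 0 < m -> exists2 L, 0 <= L &
  forall v w, m <= v -> v <= w -> h w - h v <= L * (w - v).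
Hypothesis cK : continuous K.
Hypothesis dK : forall w : R, 0 < w -> is_derive w (1 : R) K (h w)^-1.
Implicit Types (Y V : R -> R) (c r x : R).

Let cF : continuous F.
Proof. by move=> r; exact: is_derive_continuous (dF r). Qed.

Let h_ge0 w : 0 <= h w.
Proof. by have [/h0->//|/h_gt0/ltW] := leP w 0. Qed.

Let mul : -1 < mu. Proof. by case/andP: mu_itv. Qed.
Let mur : mu < 1. Proof. by case/andP: mu_itv. Qed.

Lemma potential_lt (x y : R) : -1 <= x -> x < y -> y <= mu -> F y < F x.
Proof.
move=> x1 xy ym; rewrite -[X in X < _]opprK -[X in _ < X]opprK ltrN2.
have d r : is_derive r (1 : R) (fun r => - F r) (- f r) by exact: is_deriveN.
apply: (derive_gt0_lt xy (fun r _ => d r)).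
- by move=> r _; exact: is_derive_continuous (d r).
- move=> r /andP[xr ry]; rewrite oppr_gt0 f_lt0//.
  by rewrite (le_lt_trans x1 xr) (lt_le_trans ry ym).
Qed.

Lemma potential_lt0 r : -1 < r -> r <= mu -> F r < 0.
Proof. by move=> r0 rm; rewrite -F_left; exact: potential_lt. Qed.

(** The equation for the integrated profile [Y = w + F]. *)
Record primary c Y : Prop := {
  primary_continuous : continuous Y;
  primary_left : Y (- 1) = 0;
  primary_ode : forall r : R, -1 < r < 1 ->
    is_derive r (1 : R) Y (c * h (Y r - F r)) }.

Lemma fix_primary c M Y : lip_nondecreasing M Y ->
  (forall r, -1 <= r <= 1 -> Y r = c * primitive_map F h Y r) -> primary c Y.
Proof.
move=> sY YT; have cY := lip_nondecreasing_continuous sY.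
have [T0 dT] := primitive_mapP cF ch cY.
split => //.
- by rewrite YT ?T0 ?mulr0//; lra.
- move=> r /andP[r0 r1]; apply: near_eq_is_derive (is_deriveMl c (dT r)).
  near=> y; rewrite YT//; apply/andP; split; apply/ltW; near: y.
    exact: lt_nbhsr.
  exact: lt_nbhsl.
Unshelve. all: by end_near. Qed.

Lemma maxsol_primary c : 0 <= c -> primary c (maxsol F h N c).
Proof.
move=> c0; apply: (@fix_primary c (c * N)).
  exact: maxsol_lip.
by move=> r hr; exact: maxsol_fix.
Qed.

Lemma primary_le c Y (x y : R) : 0 <= c -> primary c Y -> -1 <= x -> x <= y -> y <= 1 ->
  Y x <= Y y.
Proof.
move=> c0 pY x1 xy y1; apply: (derive_ge0_le xy (du := fun r => c * h (Y r - F r))).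
- move=> r /andP[xr ry]; apply: (primary_ode pY).
  by rewrite (le_lt_trans x1 xr) (lt_le_trans ry y1).
- by move=> r _; exact: (primary_continuous pY).
- by move=> r _; rewrite mulr_ge0.
Qed.

Lemma primary_ge0 c Y r : 0 <= c -> primary c Y -> -1 <= r <= 1 -> 0 <= Y r.
Proof.
by move=> c0 pY /andP[r0 r1]; rewrite -(primary_left pY) (primary_le c0 pY).
Qed.

Lemma primary_gt0_left c Y r : 0 <= c -> primary c Y -> -1 < r -> r <= mu ->
  0 < Y r - F r.
Proof.
move=> c0 pY r0 rm; have := potential_lt0 r0 rm.
have := @primary_ge0 c Y r c0 pY; rewrite (ltW r0) (le_trans rm (ltW mur)).
by move=> /(_ isT); lra.
Qed.

Lemma primary_ode_profile c Y r : primary c Y -> -1 < r < 1 ->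
  is_derive r (1 : R) (fun r => Y r - F r) (c * h (Y r - F r) - f r).
Proof. by move=> pY hr; exact: is_deriveB (primary_ode pY hr) (dF r). Qed.

(** At a minimum of [w = Y - F] over [[r, 1]] with [w <= 0] one has
    [w' = - f < 0], so smaller values follow. *)
Lemma primary_gt0 c Y r : 0 <= c -> primary c Y -> 0 <= Y 1 - F 1 ->
  -1 < r < 1 -> 0 < Y r - F r.
Proof.
move=> c0 pY Y1 /andP[r0 r1]; rewrite ltNge; apply/negP => Wr.
have mr : mu < r.
  by rewrite ltNge; apply/negP => rm; have := primary_gt0_left c0 pY r0 rm; lra.
pose w (s : R) := Y s - F s.
have cw : continuous w.
  by move=> s; apply: cvgB; [exact: (primary_continuous pY)|exact: cF].
have [s hs smin] : exists2 s, s \in `[r, 1] &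
    forall t, t \in `[r, 1] -> w s <= w t.
  by apply: EVT_min; [exact: ltW|exact: continuous_subspaceT].
have [s' [rs' s'1 ws' min']] : exists s', [/\ r <= s', s' < 1, w s' <= 0 &
    forall t, r <= t <= 1 -> w s' <= w t].
  have wsr : w s <= w r by apply: smin; rewrite in_itv/= lexx ltW.
  have smin' t : r <= t <= 1 -> w s <= w t by move=> ?; apply: smin; rewrite in_itv/=.
  have := hs; rewrite in_itv/= => /andP[rs]; rewrite le_eqVlt => /predU1P[s1|s1].
    exists r; split => // t ht; apply: le_trans (smin' t ht).
    by rewrite s1; exact: le_trans Wr Y1.
  by exists s; split => //; exact: le_trans wsr Wr.
have hs' : -1 < s' < 1 by rewrite s'1 (lt_le_trans r0).
have := primary_ode_profile pY hs'; rewrite (h0 ws') mulr0 sub0r => d.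
have fs' : - f s' < 0 by rewrite oppr_lt0 f_gt0// s'1 (lt_le_trans mr).
have [t /andP[st t1]] := is_derive_lt_right d fs' s'1.
apply/negP; rewrite -leNgt; apply: min'.
by rewrite (ltW t1) (le_trans rs' (ltW st)).
Qed.

(** [K] turns energies into fluxes.  Below [mu], where [f < 0], the flux of the
    larger profile grows more slowly, and both fluxes start from zero. *)
Lemma primary_uniq_left c Y V : 0 <= c -> primary c Y -> primary c V ->
  (forall r, -1 <= r <= 1 -> V r <= Y r) -> Y mu <= V mu.
Proof.
move=> c0 pY pV VY.
pose D (r : R) := K (Y r - F r) - K (V r - F r).
have cD : continuous D.
  move=> r; have [cY cV] := (primary_continuous pY, primary_continuous pV).
  apply: cvgB.
  - by apply: (@cvg_comp _ _ _ (fun r => Y r - F r) K); [apply: cvgB; [exact: cY|exact: cF]|exact: cK].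
  - by apply: (@cvg_comp _ _ _ (fun r => V r - F r) K); [apply: cvgB; [exact: cV|exact: cF]|exact: cK].
have dD r : -1 < r < mu -> is_derive r (1 : R) D
    (- f r * ((h (Y r - F r))^-1 - (h (V r - F r))^-1)).
  move=> /andP[r0 rm]; have hr : -1 < r < 1 by rewrite r0 (lt_trans rm mur).
  have Y0 := primary_gt0_left c0 pY r0 (ltW rm).
  have V0 := primary_gt0_left c0 pV r0 (ltW rm).
  have := is_deriveB
    (@is_derive1_comp _ K (fun r => Y r - F r) _ _ _ (dK Y0) (primary_ode_profile pY hr))
    (@is_derive1_comp _ K (fun r => V r - F r) _ _ _ (dK V0) (primary_ode_profile pV hr)).
  rewrite (_ : _ - _ = - f r * ((h (Y r - F r))^-1 - (h (V r - F r))^-1))//.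
  by field; rewrite !gt_eqF ?h_gt0.
have : D mu <= D (- 1).
  apply: (derive_le0_ge (ltW mul) dD) => [r _|r /andP[r0 rm]]; first exact: cD.
  have V0 := primary_gt0_left c0 pV r0 (ltW rm).
  have hr : -1 <= r <= 1 by rewrite (ltW r0) (ltW (lt_trans rm mur)).
  have hVY : V r - F r <= Y r - F r by rewrite lerB// VY.
  rewrite mulr_ge0_le0//; first by rewrite oppr_ge0 ltW// f_lt0// r0.
  rewrite subr_le0 lef_pV2 ?h_le// posrE h_gt0//.
  exact: lt_le_trans V0 hVY.
rewrite /D (primary_left pY) (primary_left pV) subrr subr_le0.
have V0 := primary_gt0_left c0 pV mul (lexx _).
have [//|VYm] := leP (Y mu) (V mu).
have lt : V mu - F mu < Y mu - F mu by rewrite ltrD2r.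
suff : K (V mu - F mu) < K (Y mu - F mu) by move=> ? ?; lra.
apply: (derive_gt0_lt lt (du := fun w => (h w)^-1)).
- by move=> s /andP[s0 _]; apply: dK; exact: lt_trans s0.
- by move=> s _; exact: cK.
- by move=> s /andP[s0 _]; rewrite invr_gt0 h_gt0//; exact: lt_trans s0.
Qed.

(** When the smaller argument is close to zero the difference of the arguments
    is bounded below, and the bound [N] on [h] suffices. *)
Lemma h_lip_above m : 0 < m -> exists2 L, 0 <= L &
  forall v w, m <= w -> v <= w -> h w - h v <= L * (w - v).
Proof.
move=> m0; have m2 : 0 < m / 2 by rewrite divr_gt0.
have [L L0 hL] := h_lip m2.
have N0 : 0 <= N by exact: le_trans (h_ge0 0) (h_leN 0).
have Nm : 0 <= N / (m / 2) by rewrite divr_ge0// ltW.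
exists (L + N / (m / 2)); first by rewrite addr_ge0.
move=> v w mw vw; have wv : 0 <= w - v by rewrite subr_ge0.
rewrite mulrDl; have [mv|vm] := leP (m / 2) v.
  by rewrite (le_trans (hL _ _ mv vw))// lerDl mulr_ge0.
have wvm : m / 2 <= w - v by lra.
have : N <= N / (m / 2) * (w - v).
  by rewrite mulrAC ler_pdivlMr// ler_wpM2l.
have := h_leN w; have := h_ge0 v; have := mulr_ge0 L0 wv; lra.
Qed.

(** The larger profile stays away from zero on [[mu, 1]], where [h] is
    Lipschitz, so the Gronwall inequality applies to the difference. *)
Lemma primary_uniq_right c Y V : 0 <= c -> primary c Y -> primary c V ->
  (forall r, -1 <= r <= 1 -> V r <= Y r) -> Y mu <= V mu ->
  0 < Y 1 - F 1 -> Y 1 <= V 1.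
Proof.
move=> c0 pY pV VY Vmu Y1.
have [cY cV] := (primary_continuous pY, primary_continuous pV).
have [s /[!in_itv]/= /andP[ms s1] smin] : exists2 s, s \in `[mu, 1] &
    forall t, t \in `[mu, 1] -> Y s - F s <= Y t - F t.
  apply: (@EVT_min _ (fun t => Y t - F t)); first exact: ltW.
  apply: continuous_subspaceT => r.
  by apply: cvgB; [exact: cY|exact: cF].
have m0 : 0 < Y s - F s.
  move: s1; rewrite le_eqVlt => /predU1P[->//|s1].
  by apply: (primary_gt0 c0 pY); [exact: ltW|rewrite s1 (lt_le_trans mul)].
have [L L0 hL] := h_lip_above m0.
rewrite -subr_le0.
have dD r : mu < r < 1 -> is_derive r (1 : R) (fun r => Y r - V r)
    (c * h (Y r - F r) - c * h (V r - F r)).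
  move=> /andP[mr r1]; have hr : -1 < r < 1 by rewrite (lt_trans mul).
  exact: is_deriveB (primary_ode pY hr) (primary_ode pV hr).
apply: (gronwall_le0 (ltW mur) dD (k := c * L)).
- by move=> r _; apply: cvgB; [exact: cY|exact: cV].
- move=> r /andP[mr r1]; rewrite -mulrBr -mulrA ler_wpM2l//.
  have := hL (V r - F r) (Y r - F r); rewrite opprB addrA subrK; apply.
    by apply: smin; rewrite in_itv/= !ltW.
  by rewrite lerB// VY// (ltW r1) (ltW (lt_trans mul mr)).
- by rewrite subr_le0.
Qed.

Let Y c := maxsol F h N c.

(** On a fixed interval to the left of [mu] every [w] is at least [- F],
    which is bounded away from zero there, so [Y] grows there by at least a fixed
    multiple of [c]. *)
Lemma maxsol_reaches : exists2 c, 0 <= c & F 1 <= Y c 1.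
Proof.
pose m := (mu - 1) / 2.
have m1 : -1 < m by rewrite /m; have := mul; have := mur; lra.
have mm : m < mu by rewrite /m; have := mul; have := mur; lra.
have Fm := potential_lt0 m1 (ltW mm).
have a0 : 0 < h (- F m) by rewrite h_gt0// oppr_gt0.
have b0 : 0 < mu - m by rewrite subr_gt0.
pose c := F 1 / (h (- F m) * (mu - m)).
have c0 : 0 <= c by rewrite divr_ge0// mulr_ge0// ltW.
exists c => //; have pY := maxsol_primary c0.
have [||x /andP[mx xmu] e] := @mean_value _ (Y c) (fun r => c * h (Y c r - F r)) m mu mm.
- move=> r /andP[mr rm]; apply: (primary_ode pY).
  by rewrite (lt_trans m1 mr) (lt_trans rm mur).
- by move=> r _; exact: (primary_continuous pY).
have h1 : Y c mu <= Y c 1 by apply: (primary_le c0 pY) => //; exact: ltW.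
have h2 : 0 <= Y c m.
  by apply: (primary_ge0 c0 pY); rewrite (ltW m1) (ltW (lt_trans mm mur)).
have : c * h (- F m) * (mu - m) = F 1.
  by rewrite /c; field; rewrite !gt_eqF.
have : c * h (- F m) * (mu - m) <= c * h (Y c x - F x) * (mu - m).
  rewrite ler_wpM2r ?(ltW b0)// ler_wpM2l// h_le//.
  have := potential_lt (ltW m1) mx (ltW xmu).
  have := @primary_ge0 c (Y c) x c0 pY.
  rewrite (ltW (lt_trans m1 mx)) (ltW (lt_trans xmu mur)) => /(_ isT).
  by lra.
by lra.
Qed.

(** The speed is the infimum of those for which the greatest solution is
    nonnegative at [1]. *)
Theorem profile_exists : exists c w,
  [/\ 0 <= c, profile f h w c & forall r, -1 <= r <= 1 -> w r <= F 1 - F r].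
Proof.
have [c1 c10 hc1] := maxsol_reaches.
pose C := [set c | 0 <= c /\ F 1 <= Y c 1].
have hC : has_inf C by split; [exists c1|exists 0 => c []].
pose c0 := inf C.
have c00 : 0 <= c0 by apply: lb_le_inf; [case: hC|move=> c []].
have above c : c0 < c -> F 1 <= Y c 1.
  move=> /(inf_lt (proj1 hC))[c' [c'0 h1] c'c]; apply: le_trans h1 _.
  by apply: maxsol_le => //; exact: ltW.
have below c : 0 <= c -> c < c0 -> Y c 1 < F 1.
  move=> c'0 cc0; rewrite ltNge; apply/negP => h1.
  have : c0 <= c by apply: ge_inf; [case: hC|].
  by rewrite leNgt cc0.
have pY := maxsol_primary c00.
have Yge : F 1 <= Y c0 1.
  pose U r := lim (Y c r @[c --> c0^'+]).
  have Ucv r : Y c r @[c --> c0^'+] --> U r.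
    apply: nondecreasing_at_right_is_cvgr.
    - near=> z => c c'; rewrite !in_itv/= => /andP[h1 _] _ cc'.
      by apply: maxsol_le => //; rewrite (le_trans c00)// ltW.
    - near=> z; exists (Y c0 r) => y [c /=]; rewrite in_itv/= => /andP[h1 _] <-.
      by apply: maxsol_le => //; exact: ltW.
  have [||sU UT] := @maxsol_lim _ F h N cF ch h_le h_ge0 h_leN (c0^'+) _ c0 (c0 + 1) U _ _ Ucv.
  - near=> c; apply/andP; split; last by near: c; apply: nbhs_right_le; rewrite ltrDl.
    by rewrite (le_trans c00)//; near: c; exact: nbhs_right_ge.
  - exact: cvg_at_right_filter.
  have U1 : F 1 <= U 1.
    apply: ler_cvg_to (cvg_cst (F 1)) (Ucv 1) _.
    by near=> c; apply: above.
  apply: le_trans U1 _.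
  apply: (maxsol_max cF ch h_le h_ge0 h_leN c00 (lip_nondecreasing_continuous sU)).
    by move=> r /UT->.
  by lra.
have Yle : Y c0 1 <= F 1.
  move: c00; rewrite le_eqVlt => /predU1P[c0E|cpos].
    have [d0 _] := primitive_mapP cF ch (primary_continuous pY).
    by rewrite /Y maxsol_fix -?c0E// ?mul0r//; lra.
  rewrite leNgt; apply/negP => Y1.
  pose V r := lim (Y c r @[c --> c0^'-]).
  have Vcv r : Y c r @[c --> c0^'-] --> V r.
    apply: nondecreasing_at_left_is_cvgr.
    - near=> z => c c'; rewrite !in_itv/= => /andP[h1 _] _ cc'.
      apply: maxsol_le => //; apply: le_trans (ltW h1).
      by near: z; exact: nbhs_left_ge.
    - near=> z; exists (Y c0 r) => y [c /=]; rewrite in_itv/= => /andP[h1 h2] <-.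
      apply: maxsol_le => //; last exact: ltW.
      apply: le_trans (ltW h1).
      by near: z; exact: nbhs_left_ge.
  have [||sV VT] := @maxsol_lim _ F h N cF ch h_le h_ge0 h_leN (c0^'-) _ c0 c0 V _ _ Vcv.
  - near=> c; apply/andP; split; last by near: c; exact: nbhs_left_le.
    by near: c; exact: nbhs_left_ge.
  - exact: cvg_at_left_filter.
  have V1 : V 1 <= F 1.
    apply: ler_cvg_to (Vcv 1) (cvg_cst (F 1)) _.
    near=> c; apply/ltW/below; last by near: c; exact: nbhs_left_lt.
    by near: c; exact: nbhs_left_ge.
  have pV := fix_primary sV VT.
  have VY r : -1 <= r <= 1 -> V r <= Y c0 r.
    apply: (maxsol_max cF ch h_le h_ge0 h_leN (ltW cpos) (lip_nondecreasing_continuous sV)).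
    by move=> s /VT->.
  have mu_le := primary_uniq_left (ltW cpos) pY pV VY.
  have := primary_uniq_right (ltW cpos) pY pV VY mu_le.
  rewrite subr_gt0 => /(_ Y1) YV.
  by have := lt_le_trans Y1 (le_trans YV V1); rewrite ltxx.
have Y1 : Y c0 1 = F 1 by apply/eqP; rewrite eq_le Yle.
exists c0, (fun r => Y c0 r - F r); split => //.
- split => //.
  + by move=> r; apply: cvgB; [exact: (primary_continuous pY)|exact: cF].
  + by rewrite F_left subr0; exact: (primary_left pY).
  + by rewrite Y1 subrr.
  + by move=> r; apply: (primary_gt0 c00 pY); rewrite subr_ge0.
  + by move=> r; exact: primary_ode_profile pY.
- move=> r /andP[r0 r1]; rewrite lerB// -Y1.
  exact: (primary_le c00 pY).
Unshelve. all: by end_near. Qed.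

End Connection.

(** * The slope as a function of the energy *)

(** The equation is written for the flux [psi p], on which its right-hand side
    depends monotonically wherever [f] keeps its sign. *)
Record slope_profile (R : realType) (f psi p : R -> R) (c : R) : Prop := {
  slope_profile_continuous : continuous p;
  slope_profile_left : p (- 1) = 0;
  slope_profile_right : p 1 = 0;
  slope_profile_gt0 : forall r : R, -1 < r < 1 -> 0 < p r;
  slope_profile_ode : forall r : R, -1 < r < 1 ->
    is_derive r (1 : R) (fun r => psi (p r)) (c - f r / p r) }.

Section EnergyInverse.
Variables (R : realType) (psi G : R -> R) (lam B : R).
Hypothesis H : legendre_pair psi G lam.
Hypothesis B0 : 0 < B.
Implicit Types v w x y : R.

Definition clamp w : R := Num.max 0 (Num.min w B).

Lemma clamp_lip : lip_nondecreasing 1 clamp.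
Proof.
move=> x y xy; rewrite /clamp mul1r.
have B0' := B0.
by case: (leP x B) => xB; [case: (leP 0 x) => x0|case: (leP 0 B) => b0];
  (case: (leP y B) => yB; [case: (leP 0 y) => y0|case: (leP 0 B) => b1]);
  apply/andP; split; lra.
Qed.

Lemma clamp_continuous : continuous clamp.
Proof. exact: lip_nondecreasing_continuous clamp_lip. Qed.

Lemma clamp_itv w : 0 <= clamp w <= B.
Proof.
have b0 := B0.
rewrite /clamp; case: (leP w B) => wB; [case: (leP 0 w)|case: (leP 0 B)] => ?;
  by apply/andP; split; lra.
Qed.

Lemma clamp_id w : 0 <= w <= B -> clamp w = w.
Proof.
by case/andP=> w0 wB; rewrite /clamp (min_idPl wB) (max_idPr w0).
Qed.

Lemma clamp_gt w : B <= w -> clamp w = B.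
Proof. by move=> wB; rewrite /clamp (min_idPr wB) max_r// ltW. Qed.

Lemma clamp_le0 w : w <= 0 -> clamp w = 0.
Proof. by move=> w0; rewrite /clamp max_l// ge_min w0. Qed.

(** Truncating the energy to [[0, B]] makes the inverse of [G] bounded; a
    profile that vanishes at both ends never exceeds the threshold. *)
Definition energy_inv w : R := xget 0 [set p | 0 <= p /\ G p = clamp w].

Lemma energy_invP w : 0 <= energy_inv w /\ G (energy_inv w) = clamp w.
Proof.
rewrite /energy_inv; case: xgetP => [p _ //|Hn]; exfalso.
have /andP[w0 _] := clamp_itv w.
have [p p0 Gp] := pair_energy_unbounded H w0.
have [||z + Gz] := @IVT _ G 0 p (clamp w) p0.
- exact: continuous_subspaceT (pair_energy_continuous H).
- by rewrite (pair_energy0 H) minElt maxElt (le_lt_trans w0 Gp) w0 ltW.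
by rewrite in_itv/= => /andP[z0 _]; exact: (Hn z).
Qed.

Lemma energy_inv_ge0 w : 0 <= energy_inv w.
Proof. by have [] := energy_invP w. Qed.

Lemma energy_invK w : G (energy_inv w) = clamp w.
Proof. by have [] := energy_invP w. Qed.

Lemma energy_inv_le : {homo energy_inv : x y / x <= y}.
Proof.
move=> x y xy; rewrite -(pair_energy_leE H) ?energy_inv_ge0// !energy_invK.
by have /andP[] := clamp_lip xy.
Qed.

Lemma energy_inv_le0 w : w <= 0 -> energy_inv w = 0.
Proof.
move=> w0; apply: (pair_energy_inj H) => //; first exact: energy_inv_ge0.
by rewrite energy_invK clamp_le0// (pair_energy0 H).
Qed.

Lemma energy_inv_gt0 w : 0 < w -> 0 < energy_inv w.
Proof.
move=> w0; rewrite -(pair_energy_ltE H) ?energy_inv_ge0// energy_invK.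
rewrite (pair_energy0 H) /clamp.
have b0 := B0.
by case: (leP w B) => wB; [case: (leP 0 w)|case: (leP 0 B)] => ?; lra.
Qed.

Lemma energy_inv_leB w : energy_inv w <= energy_inv B.
Proof.
rewrite -(pair_energy_leE H) ?energy_inv_ge0// !energy_invK (clamp_gt (lexx B)).
by have /andP[] := clamp_itv w.
Qed.

Lemma energy_inv_continuous : continuous energy_inv.
Proof.
move=> w; apply/cvgrPdist_le => e e0.
have p0 := energy_inv_ge0 w.
have up : clamp w < G (energy_inv w + e).
  by rewrite -energy_invK; apply: (pair_energy_lt H) => //; rewrite ltrDl.
have hup : \forall y \near w, energy_inv y <= energy_inv w + e.
  have : \forall y \near w, clamp y < G (energy_inv w + e).
    exact: (@cvgr_lt _ _ (nbhs w) _ clamp _ (@clamp_continuous w) _ up).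
  apply: filterS => y hy.
  rewrite -(pair_energy_leE H) ?energy_inv_ge0// ?addr_ge0 ?(ltW e0)//.
  by rewrite energy_invK ltW.
have hlo : \forall y \near w, energy_inv w - e <= energy_inv y.
  have [we|we] := leP (energy_inv w) e.
    by near=> y; apply: le_trans (energy_inv_ge0 y); rewrite subr_le0.
  have pe : 0 <= energy_inv w - e by rewrite subr_ge0 ltW.
  have lo : G (energy_inv w - e) < clamp w.
    by rewrite -energy_invK; apply: (pair_energy_lt H) => //; rewrite ltrBlDr ltrDl.
  have : \forall y \near w, G (energy_inv w - e) < clamp y.
    exact: (@cvgr_gt _ _ (nbhs w) _ clamp _ (@clamp_continuous w) _ lo).
  apply: filterS => y hy.
  by rewrite -(pair_energy_leE H) ?energy_inv_ge0// energy_invK ltW.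
near=> y; rewrite ler_distlC; apply/andP; split; near: y.
  exact: hlo.
exact: hup.
Unshelve. all: by end_near. Qed.

Lemma energy_inv_lip m : 0 < m -> exists2 L, 0 <= L & forall v w,
  m <= v -> v <= w -> energy_inv w - energy_inv v <= L * (w - v).
Proof.
move=> m0; have a0 : 0 < lam * psi (energy_inv m).
  by rewrite mulr_gt0 ?(pair_lam_gt0 H)// (pair_flux_gt0 H) ?energy_inv_gt0.
exists (lam * psi (energy_inv m))^-1; first by rewrite invr_ge0 ltW.
move=> v w mv vw; rewrite mulrC ler_pdivlMr// mulrC.
have hvw := energy_inv_le vw.
have := pair_energy_coercive H (energy_inv_ge0 v) hvw.
rewrite !energy_invK; have /andP[_] := clamp_lip vw; rewrite mul1r => c1 c2.
have : lam * psi (energy_inv m) * (energy_inv w - energy_inv v) <=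
       lam * psi (energy_inv v) * (energy_inv w - energy_inv v).
  rewrite ler_wpM2r ?subr_ge0// ler_pM2l ?(pair_lam_gt0 H)//.
  by rewrite (pair_flux_le H) ?energy_inv_ge0// energy_inv_le.
by lra.
Qed.

(** The flux as a function of the energy, continued affinely past [B] so that
    its derivative stays the inverse of the truncated lip_nondecreasing. *)
Definition flux_of_energy w : R :=
  psi (energy_inv w) + Num.max (w - B) 0 / energy_inv B.

Lemma flux_of_energyE w : w <= B -> flux_of_energy w = psi (energy_inv w).
Proof. by move=> wB; rewrite /flux_of_energy max_r ?mul0r ?addr0// subr_le0. Qed.

Lemma flux_of_energy_continuous : continuous flux_of_energy.
Proof.
move=> w; apply: cvgD.
  apply: (@cvg_comp _ _ _ energy_inv psi); first exact: energy_inv_continuous.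
  exact: (pair_flux_continuous H).
apply: cvgM; last exact: cvg_cst.
have s1 : lip_nondecreasing 1 (fun w => Num.max (w - B) 0).
  move=> x y xy; rewrite mul1r.
  by case: (leP (x - B) 0) => ?; case: (leP (y - B) 0) => ?; apply/andP; split; lra.
exact: lip_nondecreasing_continuous s1 w.
Qed.

(** Below [B] the two bounds on the increments of the energy enclose the
    difference quotient of the flux between the inverses of the two slopes. *)
Lemma is_derive_flux_of_energy w : 0 < w ->
  is_derive w (1 : R) flux_of_energy (energy_inv w)^-1.
Proof.
have civ w' : 0 < w' -> {for w', continuous (fun w => (energy_inv w)^-1)}.
  move=> w0; apply: cvgV; first by rewrite gt_eqF// energy_inv_gt0.
  exact: energy_inv_continuous.
have below w' : 0 < w' -> w' < B ->
    is_derive w' (1 : R) flux_of_energy (energy_inv w')^-1.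
  move=> w0 wB; apply: (near_eq_is_derive (f := fun w => psi (energy_inv w))).
    near=> y; rewrite flux_of_energyE//; apply/ltW; near: y; exact: lt_nbhsl.
  apply/is_derive_epsP => e e0; near=> y.
  have y0 : 0 < y by near: y; exact: lt_nbhsr.
  have yB : y < B by near: y; exact: lt_nbhsl.
  have he : `|(energy_inv w')^-1 - (energy_inv y)^-1| <= e.
    by near: y; move/cvgrPdist_le : (civ _ w0); exact.
  have p0 := energy_inv_gt0 w0; have q0 := energy_inv_gt0 y0.
  have Gp : G (energy_inv w') = w' by rewrite energy_invK clamp_id// !ltW.
  have Gq : G (energy_inv y) = y by rewrite energy_invK clamp_id// !ltW.
  apply: le_trans (_ : `|(energy_inv w')^-1 - (energy_inv y)^-1| * `|y - w'| <= _);
    last by rewrite ler_wpM2r.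
  have [wy|/ltW yw] := leP w' y.
  - have pq := energy_inv_le wy.
    have := pair_energy_ge H (ltW p0) pq; have := pair_energy_le H (ltW p0) pq.
    rewrite Gp Gq [_ * (psi _ - _)]mulrC -ler_pdivrMr// => h1.
    rewrite [_ * (psi _ - _)]mulrC -ler_pdivlMr// => h2.
    rewrite (ger0_norm (_ : 0 <= y - w')) ?subr_ge0//.
    rewrite [X in _ <= X * _]ger0_norm; last by rewrite subr_ge0 lef_pV2.
    by rewrite [leLHS]ler0_norm; lra.
  - have pq := energy_inv_le yw.
    have := pair_energy_ge H (ltW q0) pq; have := pair_energy_le H (ltW q0) pq.
    rewrite Gp Gq [_ * (psi _ - _)]mulrC -ler_pdivrMr// => h1.
    rewrite [_ * (psi _ - _)]mulrC -ler_pdivlMr// => h2.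
    rewrite (ler0_norm (_ : y - w' <= 0)) ?subr_le0//.
    rewrite [X in _ <= X * _]ler0_norm; last by rewrite subr_le0 lef_pV2.
    by rewrite [leLHS]ler0_norm; lra.
have above w' : B < w' -> is_derive w' (1 : R) flux_of_energy (energy_inv w')^-1.
  move=> Bw.
  have EB y : B < y -> energy_inv y = energy_inv B.
    move=> By; apply: (pair_energy_inj H); rewrite ?energy_inv_ge0//.
    by rewrite !energy_invK !clamp_gt// ltW.
  apply: (near_eq_is_derive (f := fun y =>
    (energy_inv B)^-1 * y + (psi (energy_inv B) - B / energy_inv B))).
    near=> y; have By : B < y by near: y; exact: lt_nbhsr.
    rewrite /flux_of_energy EB// max_l; last by rewrite subr_ge0 ltW.
    by rewrite mulrBl; ring.
  rewrite EB//; have := is_deriveD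
    (is_deriveMl (energy_inv B)^-1 (is_derive_id w' (1 : R)))
    (is_derive_cst (psi (energy_inv B) - B / energy_inv B) w' (1 : R)).
  by rewrite mulr1 addr0.
move=> w0; have [wB|wB|->] := ltgtP w B; [exact: below|exact: above|].
apply: (is_derive_extend (v := fun w => (energy_inv w)^-1)).
- near=> y; have [yB|yB|yB] := ltgtP y B.
  + by apply: below => //; near: y; apply: nbhs_dnbhs; exact: lt_nbhsr.
  + exact: above.
  + by exfalso; move: yB; apply/eqP; near: y; exact: nbhs_dnbhs_neq.
- exact: flux_of_energy_continuous.
- exact: civ.
Unshelve. all: by end_near. Qed.

End EnergyInverse.

(** * From a profile to a travelling wave *)

Lemma lipschitz_is_continuous (R : realType) (f : R -> R) :
  lipschitz f -> continuous f.
Proof.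
move=> /pinfty_ex_gt0[M M0 hM] x; apply/cvgrPdist_le => e e0.
near=> y; apply: le_trans (_ : M * `|x - y| <= _); first exact: (hM (x, y)).
rewrite mulrC -ler_pdivlMr//; near: y; apply: near_dist_le.
by rewrite divr_gt0.
Unshelve. all: by end_near. Qed.

(** A primitive of [f] on the whole line, differentiable also at [-1] and [1].
    The value at [1] is nonnegative as a limit of the hypothesis on the
    potential. *)
Lemma bistable_potential (R : realType) (f : R -> R) (mu : R) :
  bistable f mu -> exists F : R -> R,
    [/\ forall r : R, is_derive r (1 : R) F (f r), F (- 1) = 0,
        forall r, -1 <= r -> primitive f r = F r & 0 <= F 1].
Proof.
move=> bf; have cf := lipschitz_is_continuous (bistable_lipschitz bf).
have [F F0 dF'] : exists2 F : R -> R, F (- 1) = 0 &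
    forall x, setT x -> is_derive x (1 : R) F (f x).
  by apply: antiderivative => // [|x _]; [exact: openT|exact: cf].
have dF r : is_derive r (1 : R) F (f r) by exact: dF'.
have cF : continuous F by move=> r; exact: is_derive_continuous (dF r).
have FE r : -1 <= r -> primitive f r = F r.
  rewrite le_eqVlt => /predU1P[<-|r1].
    by rewrite /primitive set_itv1 Rintegral_set1 F0.
  rewrite /primitive /Rintegral (@continuous_FTC2 _ f F)//.
  - by rewrite F0 oppe0 adde0.
  - exact: continuous_subspaceT.
  - split => [x _||]; first by have [] := dF x.
    + by apply: cvg_at_right_filter; exact: cF.
    + by apply: cvg_at_left_filter; exact: cF.
  - by move=> x _; exact: is_derive1_val.
have Flt r : -1 < r < 1 -> F r < F 1.
  move=> /[dup] hr /andP[r0 r1]; have := bistable_primitive bf hr.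
  by rewrite (FE r (ltW r0)) (FE 1 _) ?subr_gt0//; lra.
exists F; split => //.
have F0r : F r @[r --> (-1 : R)^'+] --> (0 : R).
  by rewrite -F0; apply: cvg_at_right_filter; exact: cF.
apply: ler_cvg_to F0r (cvg_cst (F 1)) _.
near=> r; apply/ltW/Flt; apply/andP; split; near: r.
  exact: nbhs_right_gt.
by apply: nbhs_right_lt; lra.
Unshelve. all: by end_near. Qed.

(** A profile [w] vanishing at [1] satisfies [w <= F 1 - F], so the truncation
    threshold [B] is chosen above that bound. *)
Lemma slope_profile_exists (R : realType) (f psi G : R -> R) (lam mu : R) :
  bistable f mu -> legendre_pair psi G lam ->
  exists c p, slope_profile f psi p c.
Proof.
move=> bf H; have [F [dF F0 _ F1]] := bistable_potential bf.
have cF : continuous F by move=> r; exact: is_derive_continuous (dF r).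
have [s _ smax] : exists2 s, s \in `[-1, 1] &
    forall t, t \in `[-1, 1] -> F 1 - F t <= F 1 - F s.
  apply: (@EVT_max _ (fun t => F 1 - F t)); first by lra.
  by apply: continuous_subspaceT => r; apply: cvgB; [exact: cvg_cst|exact: cF].
pose B := `|F 1 - F s| + 1.
have B0 : 0 < B by rewrite ltr_wpDl.
have hB r : -1 <= r <= 1 -> F 1 - F r <= B.
  move=> hr; apply: le_trans (smax r _) _; first by rewrite in_itv.
  by rewrite (le_trans (ler_norm _))// lerDl.
have civ := energy_inv_continuous H B0.
have [c [w [c0 pw wle]]] : exists c w, [/\ 0 <= c,
    profile f (energy_inv G B) w c & forall r, -1 <= r <= 1 -> w r <= F 1 - F r].
  apply: (@profile_exists _ f F (energy_inv G B) (flux_of_energy psi G B)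
    (energy_inv G B B) mu) => //.
  - exact: bistable_mu bf.
  - exact: bistable_neg bf.
  - exact: bistable_pos bf.
  - exact: energy_inv_le H B0.
  - exact: energy_inv_le0 H B0.
  - exact: energy_inv_gt0 H B0.
  - exact: energy_inv_leB H B0.
  - exact: energy_inv_lip H B0.
  - exact: flux_of_energy_continuous H B0.
  - exact: is_derive_flux_of_energy H B0.
exists c, (fun r => energy_inv G B (w r)); split.
- move=> r; apply: (@cvg_comp _ _ _ w); first exact: (profile_continuous pw).
  exact: civ.
- by rewrite (profile_left pw) (energy_inv_le0 H B0).
- by rewrite (profile_right pw) (energy_inv_le0 H B0).
- by move=> r hr; apply: (energy_inv_gt0 H B0); exact: (profile_gt0 pw).
- move=> r hr; have w0 := profile_gt0 pw hr; have /andP[r0 r1] := hr.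
  apply: (near_eq_is_derive (f := fun r => flux_of_energy psi G B (w r))).
    near=> y; rewrite flux_of_energyE//.
    have hy : -1 <= y <= 1.
      apply/andP; split; apply/ltW; near: y; [exact: lt_nbhsr|exact: lt_nbhsl].
    exact: le_trans (wle y hy) (hB y hy).
  have := @is_derive1_comp _ (flux_of_energy psi G B) w _ _ _
    (is_derive_flux_of_energy H B0 w0) (profile_ode pw hr).
  have p0 := energy_inv_gt0 H B0 w0.
  rewrite (_ : _ * _ = c - f r / energy_inv G B (w r))//.
  by field; rewrite gt_eqF.
Unshelve. all: by end_near. Qed.

Section WaveOfProfile.
Variables (R : realType) (f psi p : R -> R) (c mu : R).
Hypothesis sp : slope_profile f psi p c.
Hypothesis mu_itv : -1 < mu < 1.
Implicit Types (r x y : R).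

(** Separation of variables in [q' = - p(q)]. *)
Lemma position_exists : exists2 X : R -> R, X mu = 0 &
  forall r, -1 < r < 1 -> is_derive r (1 : R) X (- (p r)^-1).
Proof.
have [||||X X0 dX] := @antiderivative R `]-1, 1[%classic (fun r => - (p r)^-1) mu.
- exact: interval_open.
- exact: interval_is_interval.
- by rewrite /= in_itv.
- move=> r; rewrite /= in_itv/= => hr; apply: cvgN; apply: cvgV.
    by rewrite gt_eqF// (slope_profile_gt0 sp).
  exact: (slope_profile_continuous sp).
by exists X => // r hr; apply: dX; rewrite /= in_itv.
Qed.

Variable X : R -> R.
Hypothesis X_mu : X mu = 0.
Hypothesis dX : forall r : R, -1 < r < 1 -> is_derive r (1 : R) X (- (p r)^-1).

Lemma position_lt r s : -1 < r -> r < s -> s < 1 -> X s < X r.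
Proof.
move=> r0 rs s1; rewrite -[X r]opprK -[X s]opprK ltrN2.
have d t : r <= t <= s -> is_derive t (1 : R) (fun t => - X t) (- - (p t)^-1).
  move=> /andP[rt ts]; apply: is_deriveN; apply: dX.
  by rewrite (lt_le_trans r0 rt) (le_lt_trans ts s1).
apply: (derive_gt0_lt rs (u := fun t => - X t) (du := fun t => - - (p t)^-1)).
- by move=> t /andP[rt ts]; apply: d; rewrite !ltW.
- by move=> t ht; exact: is_derive_continuous (d t ht).
- move=> t /andP[rt ts]; rewrite opprK invr_gt0 (slope_profile_gt0 sp)//.
  by rewrite (lt_trans r0 rt) (lt_trans ts s1).
Qed.

Lemma position_ltE r s : -1 < r < 1 -> -1 < s < 1 -> (X s < X r) = (r < s).
Proof.
move=> /andP[r0 r1] /andP[s0 s1]; case: (ltgtP r s) => [rs|sr|->].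
- by rewrite position_lt.
- by apply/negbTE; rewrite -leNgt ltW// position_lt.
- by rewrite ltxx.
Qed.

(** The inverse of the position [X], continued by the constant states beyond the
    range of [X]. *)
Definition wave x : R :=
  xget (if x < 0 then 1 else -1) [set r | -1 < r < 1 /\ X r = x].

Lemma waveP x : -1 < wave x < 1 /\ X (wave x) = x \/
  [/\ x < 0, wave x = 1 & forall r, -1 < r < 1 -> x < X r] \/
  [/\ 0 < x, wave x = -1 & forall r, -1 < r < 1 -> X r < x].
Proof.
rewrite /wave; case: xgetP => [r _ [hr Xr]|Hn]; first by left.
have notin r : -1 < r < 1 -> X r <> x by move=> hr Xr; exact: (Hn r).
have cX r : -1 < r < 1 -> {for r, continuous X}.
  by move=> hr; exact: is_derive_continuous (dX hr).
have cXs a b : -1 < a -> b < 1 -> {within `[a, b], continuous X}.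
  move=> a0 b1; apply: continuous_in_subspaceT => t /set_mem/=.
  rewrite in_itv/= => /andP[ht1 ht2]; apply: cX.
  by rewrite (lt_le_trans a0) ?(le_lt_trans ht2).
have /andP[mu0 mu1] := mu_itv.
have x0 : x != 0 by apply/eqP => x0; apply: (notin mu) => //; rewrite X_mu.
right; have [xlt|xgt|/eqP] := ltgtP x 0; last by rewrite (negbTE x0).
- left; split => // r hr; rewrite ltNge; apply/negP => Xr.
  have /andP[r0 r1] := hr.
  have mr : mu < r.
    by rewrite -position_ltE// X_mu; exact: le_lt_trans Xr xlt.
  have [||t + Xt] := @IVT _ X mu r x (ltW mr).
  - exact: cXs.
  - by rewrite X_mu minElt maxElt; case: ltP => ?; rewrite ?Xr ?(ltW xlt)//; lra.
  rewrite in_itv/= => /andP[t1 t2]; apply: (notin t) => //.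
  by rewrite (lt_le_trans mu0) ?(le_lt_trans t2).
- right; split => // r hr; rewrite ltNge; apply/negP => Xr.
  have /andP[r0 r1] := hr.
  have mr : r < mu.
    by rewrite -position_ltE// X_mu; exact: lt_le_trans xgt Xr.
  have [||t + Xt] := @IVT _ X r mu x (ltW mr).
  - exact: cXs.
  - by rewrite X_mu minElt maxElt; case: ltP => ?; rewrite ?Xr ?(ltW xgt)//; lra.
  rewrite in_itv/= => /andP[t1 t2]; apply: (notin t) => //.
  by rewrite (lt_le_trans r0) ?(le_lt_trans t2).
Qed.

Lemma wave_itv x : -1 <= wave x <= 1.
Proof.
have [[/andP[h1 h2] _]|[[_ -> _]|[_ -> _]]] := waveP x.
- by rewrite !ltW.
- by apply/andP; split; lra.
- by apply/andP; split; lra.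
Qed.

Lemma wave_position r : -1 < r < 1 -> wave (X r) = r.
Proof.
move=> hr; have [[h1 h2]|[[_ _ /(_ r hr)]|[_ _ /(_ r hr)]]] := waveP (X r);
  rewrite ?ltxx//.
have := position_ltE hr h1; rewrite h2 ltxx => /esym.
have := position_ltE h1 hr; rewrite h2 ltxx => /esym.
by case: ltgtP.
Qed.

Lemma lt_wave r x : -1 < r < 1 -> (r < wave x) = (x < X r).
Proof.
move=> hr; have /andP[r0 r1] := hr.
have [[h1 h2]|[[_ -> /(_ r hr)->]//|[_ -> /(_ r hr) h]]] := waveP x.
- by rewrite -[in RHS]h2 position_ltE.
- by rewrite !ltNge !ltW.
Qed.

Lemma wave_lt r x : -1 < r < 1 -> (wave x < r) = (X r < x).
Proof.
move=> hr; have /andP[r0 r1] := hr.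
have [[h1 h2]|[[_ -> /(_ r hr) h]|[_ -> /(_ r hr)->]//]] := waveP x.
- by rewrite -[in RHS]h2 position_ltE.
- by rewrite !ltNge !ltW.
Qed.

Lemma wave_le x y : x <= y -> wave y <= wave x.
Proof.
move=> xy; rewrite leNgt; apply/negP => yx.
have /andP[x0 x1] := wave_itv x; have /andP[y0 y1] := wave_itv y.
pose r := (wave x + wave y) / 2.
have hr : -1 < r < 1 by rewrite /r; apply/andP; split; lra.
have h1 : wave x < r by rewrite /r; lra.
have h2 : r < wave y by rewrite /r; lra.
move: h1 h2; rewrite wave_lt// lt_wave// => h1 h2.
by have := lt_le_trans (lt_trans h2 h1) xy; rewrite ltxx.
Qed.

Lemma wave_continuous : continuous wave.
Proof.
move=> x; apply/cvgrPdist_le => e e0.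
have /andP[x0 x1] := wave_itv x.
have up : \forall y \near x, wave y <= wave x + e.
  have [h|h] := leP 1 (wave x + e).
    by near=> y; apply: le_trans h; have /andP[] := wave_itv y.
  have hr : -1 < wave x + e < 1 by rewrite h andbT; lra.
  have : X (wave x + e) < x by rewrite -wave_lt// ltrDl.
  move=> /lt_nbhsr; apply: filterS => y; rewrite -wave_lt//; exact: ltW.
have lo : \forall y \near x, wave x - e <= wave y.
  have [h|h] := leP (wave x - e) (- 1).
    by near=> y; apply: (le_trans h); have /andP[] := wave_itv y.
  have hr : -1 < wave x - e < 1 by rewrite h; lra.
  have : x < X (wave x - e) by rewrite -lt_wave// ltrBlDr ltrDl.
  move=> /lt_nbhsl; apply: filterS => y; rewrite -lt_wave//; exact: ltW.
near=> y; rewrite ler_distlC; apply/andP; split; near: y; [exact: lo|exact: up].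
Unshelve. all: by end_near. Qed.

Lemma wave_cvgNy : wave x @[x --> -oo] --> (1 : R).
Proof.
apply/cvgrPdist_le => e e0.
pose r : R := 1 - Num.min e 1.
have m0 : 0 < Num.min e 1 by rewrite lt_min e0 ltr01.
have m1 : Num.min e 1 <= 1 by rewrite ge_min lexx orbT.
have me : Num.min e 1 <= e by rewrite ge_min lexx.
have hr : -1 < r < 1 by rewrite /r; apply/andP; split; lra.
have : \forall x \near -oo, x < X r by apply: nbhs_ninfty_lt; exact: num_real.
apply: filterS => x; rewrite -lt_wave// => h.
have /andP[_ h1] := wave_itv x.
by rewrite ger0_norm ?subr_ge0//; rewrite /r in h; lra.
Qed.

Lemma wave_cvgy : wave x @[x --> +oo] --> (-1 : R).
Proof.
apply/cvgrPdist_le => e e0.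
pose r : R := -1 + Num.min e 1.
have m0 : 0 < Num.min e 1 by rewrite lt_min e0 ltr01.
have m1 : Num.min e 1 <= 1 by rewrite ge_min lexx orbT.
have me : Num.min e 1 <= e by rewrite ge_min lexx.
have hr : -1 < r < 1 by rewrite /r; apply/andP; split; lra.
have : \forall x \near +oo, X r < x by apply: nbhs_pinfty_gt; exact: num_real.
apply: filterS => x; rewrite -wave_lt// => h.
have /andP[h1 _] := wave_itv x.
by rewrite ler0_norm ?subr_le0//; rewrite /r in h; lra.
Qed.

Lemma is_derive_wave_in x : -1 < wave x < 1 ->
  is_derive x (1 : R) wave (- p (wave x)).
Proof.
move=> hx; have [[_ h2]|[[_ e _]|[_ e _]]] := waveP x; last 2 first.
- by move: hx; rewrite e; lra.
- by move: hx; rewrite e; lra.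
have /andP[x0 x1] := hx.
have nb : \forall r \near wave x, -1 < r < 1.
  by near=> r; apply/andP; split; near: r; [exact: lt_nbhsr|exact: lt_nbhsl].
rewrite -[x in is_derive x]h2 -[p _]invrK -invrN.
apply: is_derive_inverse; last 2 first.
- exact: dX.
- by rewrite oppr_eq0 invr_eq0 gt_eqF// (slope_profile_gt0 sp).
- by apply: filterS nb => r; exact: wave_position.
- by apply: filterS nb => r hr; exact: is_derive_continuous (dX hr).
Unshelve. all: by end_near. Qed.

(** Wherever the wave has left the constant states the derivative is known; it
    extends continuously, by the value zero, across the at most two points at
    which a constant state is reached. *)
Lemma is_derive_wave_comp (u v : R -> R) :
  continuous u -> continuous v -> v 1 = 0 -> v (- 1) = 0 ->
  (forall x, -1 < wave x < 1 ->
    is_derive x (1 : R) (fun x => u (wave x)) (v (wave x))) ->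
  forall x, is_derive x (1 : R) (fun x => u (wave x)) (v (wave x)).
Proof.
move=> cu cv v1 vN1 hd x.
have cuw y : {for y, continuous (fun x => u (wave x))}.
  by apply: (@cvg_comp _ _ _ wave u); [exact: wave_continuous|exact: cu].
have cvw y : {for y, continuous (fun x => v (wave x))}.
  by apply: (@cvg_comp _ _ _ wave v); [exact: wave_continuous|exact: cv].
have cst y a : (\forall z \near y, wave z = a) ->
    is_derive y (1 : R) (fun x => u (wave x)) 0.
  move=> ha; apply: (near_eq_is_derive (f := fun=> u a)).
  by apply: filterS ha => z ->.
have top y z : y < z -> wave z = 1 -> \forall t \near y, wave t = 1.
  move=> yz wz; have := lt_nbhsl yz; apply: filterS => t /ltW/wave_le.
  by rewrite wz => h; apply/eqP; rewrite eq_le h andbT; have /andP[] := wave_itv t.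
have bot y z : z < y -> wave z = -1 -> \forall t \near y, wave t = -1.
  move=> yz wz; have := lt_nbhsr yz; apply: filterS => t /ltW/wave_le.
  by rewrite wz => h; apply/eqP; rewrite eq_le h /=; have /andP[] := wave_itv t.
have /andP[] := wave_itv x; rewrite le_eqVlt => /predU1P[wx _|x0].
  have [[z zx wz]|nz] := pselect (exists2 z, z < x & wave z = -1).
    by rewrite -wx vN1; apply: cst; exact: bot wz.
  apply: (is_derive_extend (v := fun x => v (wave x))) => //.
  have lt1 : wave x < 1 by rewrite -wx; lra.
  have : \forall y \near x, wave y < 1.
    exact: (@cvgr_lt _ _ (nbhs x) _ wave _ (@wave_continuous x) _ lt1).
  move=> /nbhs_dnbhs h1; near=> y.
  have [xy|yx|xy] := ltgtP x y.
  - have wy : wave y = -1.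
      by apply/eqP; rewrite eq_le; have /andP[-> _] := wave_itv y; rewrite wx wave_le// ltW.
    by rewrite wy vN1; apply: cst; exact: bot xy _.
  - apply: hd; apply/andP; split; last by near: y.
    have /andP[] := wave_itv y; rewrite le_eqVlt => /predU1P[wy|//] _.
    by exfalso; apply: nz; exists y.
  - by exfalso; move: xy; apply/eqP; rewrite eq_sym; near: y; exact: nbhs_dnbhs_neq.
rewrite le_eqVlt => /predU1P[wx|x1]; last by apply: hd; rewrite x0.
have [[z zx wz]|nz] := pselect (exists2 z, x < z & wave z = 1).
  by rewrite wx v1; apply: cst; exact: top wz.
apply: (is_derive_extend (v := fun x => v (wave x))) => //.
have : \forall y \near x, -1 < wave y.
  exact: (@cvgr_gt _ _ (nbhs x) _ wave _ (@wave_continuous x) _ x0).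
move=> /nbhs_dnbhs h1; near=> y.
have [xy|yx|xy] := ltgtP x y.
- apply: hd; apply/andP; split; first by near: y.
  have /andP[_] := wave_itv y; rewrite le_eqVlt => /predU1P[wy|//].
  by exfalso; apply: nz; exists y.
- have wy : wave y = 1.
    by apply/eqP; rewrite eq_le; have /andP[_ ->] := wave_itv y; rewrite -wx wave_le// ltW.
  by rewrite wy v1; apply: cst; exact: top yx _.
- by exfalso; move: xy; apply/eqP; rewrite eq_sym; near: y; exact: nbhs_dnbhs_neq.
Unshelve. all: by end_near. Qed.

Lemma is_derive_wave x : is_derive x (1 : R) wave (- p (wave x)).
Proof.
apply: (@is_derive_wave_comp id (fun r => - p r)).
- by move=> y; exact: cvg_id.
- by move=> y; apply: cvgN; exact: (slope_profile_continuous sp).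
- by rewrite (slope_profile_right sp) oppr0.
- by rewrite (slope_profile_left sp) oppr0.
- by move=> y; exact: is_derive_wave_in.
Qed.

Lemma wave_travelling (Phi : R -> R) : continuous f -> f 1 = 0 -> f (- 1) = 0 ->
  continuous psi -> derive1 Phi = psi -> (forall z, psi (- z) = - psi z) ->
  travelling_wave f Phi mu wave c.
Proof.
move=> cf f1 fN1 cpsi Phi' psiN.
have cp := slope_profile_continuous sp.
have wE : derive1 wave = fun x => - p (wave x).
  by apply/funext => x; exact: is_derive1_val (is_derive_wave x).
have dflux x : is_derive x (1 : R) (fun y => derive1 Phi (derive1 wave y))
    (c * p (wave x) - f (wave x)).
  rewrite Phi' wE (_ : (fun y => _) = fun y => - psi (p (wave y))); last first.
    by apply/funext => y; rewrite psiN.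
  apply: (@is_derive_wave_comp (fun r => - psi (p r)) (fun r => c * p r - f r)).
  - move=> r; apply: cvgN; apply: (@cvg_comp _ _ _ p psi); [exact: cp|exact: cpsi].
  - move=> r; apply: cvgB; last exact: cf.
    by apply: cvgM; [exact: cvg_cst|exact: cp].
  - by rewrite (slope_profile_right sp) mulr0 f1 subr0.
  - by rewrite (slope_profile_left sp) mulr0 fN1 subr0.
  - move=> y hy; have p0 := slope_profile_gt0 sp hy.
    have := is_deriveN (@is_derive1_comp _ (fun r => psi (p r)) wave _ _ _
      (slope_profile_ode sp hy) (is_derive_wave y)).
    rewrite (_ : - ((c - f (wave y) / p (wave y)) * - p (wave y)) =
      c * p (wave y) - f (wave y))//.
    by field; rewrite gt_eqF.
split.
- move=> x _; split; first by have [] := is_derive_wave x.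
  rewrite wE; apply: cvgN; apply: (@cvg_comp _ _ _ wave p); last exact: cp.
  exact: wave_continuous.
- by move=> x; have [] := dflux x.
- by move=> x; rewrite (is_derive1_val (dflux x)) wE; ring.
- move=> x; rewrite wE oppr_le0.
  have /andP[] := wave_itv x; rewrite le_eqVlt => /predU1P[<- _|x0].
    by rewrite (slope_profile_left sp).
  rewrite le_eqVlt => /predU1P[->|x1]; first by rewrite (slope_profile_right sp).
  by rewrite ltW// (slope_profile_gt0 sp)// x0.
- exact: wave_cvgNy.
- exact: wave_cvgy.
- by rewrite -X_mu wave_position.
Qed.

End WaveOfProfile.

Theorem travelling_wave_exists (R : realType) (f phi Phi : R -> R) (mu : R) :
  bistable f mu -> admissible_energy phi Phi ->
  exists q c, travelling_wave f Phi mu q c.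
Proof.
move=> bf /admissible_legendre_pair[lam H].
have [c [p sp]] := slope_profile_exists bf H.
have [X X0 dX] := position_exists sp (bistable_mu bf).
have [fN1 _ f1] := bistable_zeros bf.
exists (wave X), c; apply: (wave_travelling sp (bistable_mu bf) X0 dX) => //.
- exact: lipschitz_is_continuous (bistable_lipschitz bf).
- exact: pair_flux_continuous H.
- exact: pair_flux_odd H.
Qed.

(** * A priori analysis of a travelling wave *)

Lemma le_lim_pinfty (R : realType) (u : R -> R) (x l : R) :
  (forall y, x <= y -> u x <= u y) -> u y @[y --> +oo] --> l -> u x <= l.
Proof.
move=> hu ul; apply: ler_cvg_to (cvg_cst (u x)) ul _.
by near=> y; apply: hu; near: y; apply: nbhs_pinfty_ge; exact: num_real.
Unshelve. all: by end_near. Qed.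

Lemma lim_pinfty_le (R : realType) (u : R -> R) (x l : R) :
  (forall y, x <= y -> u y <= u x) -> u y @[y --> +oo] --> l -> l <= u x.
Proof.
move=> hu ul; apply: ler_cvg_to ul (cvg_cst (u x)) _.
by near=> y; apply: hu; near: y; apply: nbhs_pinfty_ge; exact: num_real.
Unshelve. all: by end_near. Qed.

Lemma le_lim_ninfty (R : realType) (u : R -> R) (x l : R) :
  (forall y, y <= x -> u x <= u y) -> u y @[y --> -oo] --> l -> u x <= l.
Proof.
move=> hu ul; apply: ler_cvg_to (cvg_cst (u x)) ul _.
by near=> y; apply: hu; near: y; apply: nbhs_ninfty_le; exact: num_real.
Unshelve. all: by end_near. Qed.

Lemma lim_ninfty_le (R : realType) (u : R -> R) (x l : R) :
  (forall y, y <= x -> u y <= u x) -> u y @[y --> -oo] --> l -> l <= u x.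
Proof.
move=> hu ul; apply: ler_cvg_to ul (cvg_cst (u x)) _.
by near=> y; apply: hu; near: y; apply: nbhs_ninfty_le; exact: num_real.
Unshelve. all: by end_near. Qed.

Section WaveAnalysis.
Variables (R : realType) (f F G Phi : R -> R) (lam mu : R).
Hypothesis bf : bistable f mu.
Hypothesis dF : forall r : R, is_derive r (1 : R) F (f r).
Hypothesis F_left : F (- 1) = 0.
Hypothesis F_right : 0 <= F 1.
Hypothesis H : legendre_pair (derive1 Phi) G lam.
Implicit Types (r x y : R).

Section OneWave.
Variables (q : R -> R) (c : R).
Hypothesis tw : travelling_wave f Phi mu q c.

Definition wave_slope x : R := - derive1 q x.
Local Notation p := wave_slope.
Local Notation psi := (derive1 Phi).

Lemma wave_slope_ge0 x : 0 <= p x.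
Proof. by rewrite oppr_ge0; exact: (wave_le0 tw). Qed.

Lemma wave_slope_continuous : continuous p.
Proof. by move=> x; apply: cvgN; have [] := wave_C1 tw (x := x) I. Qed.

Lemma is_derive_travelling x : is_derive x (1 : R) q (- p x).
Proof. by rewrite opprK; apply: is_derive1P; have [] := wave_C1 tw (x := x) I. Qed.

Lemma travelling_continuous : continuous q.
Proof. by move=> x; exact: is_derive_continuous (is_derive_travelling x). Qed.

Lemma is_derive_wave_flux x :
  is_derive x (1 : R) (fun y => psi (p y)) (f (q x) - c * p x).
Proof.
have -> : (fun y => psi (p y)) = fun y => - psi (derive1 q y).
  by apply/funext => y; rewrite (pair_flux_odd H).
have := is_deriveN (is_derive1P (@wave_flux _ _ _ _ _ _ tw x)).
rewrite (_ : - derive1 _ x = f (q x) - c * p x)//.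
by have := wave_eq tw x; rewrite /p mulrN opprK; lra.
Qed.

Lemma travelling_le x y : x <= y -> q y <= q x.
Proof.
move=> xy; apply: (derive_le0_ge xy (du := fun x => - p x)).
- by move=> z _; exact: is_derive_travelling.
- by move=> z _; exact: travelling_continuous.
- by move=> z _; rewrite oppr_le0 wave_slope_ge0.
Qed.

Lemma travelling_itv x : -1 <= q x <= 1.
Proof.
apply/andP; split.
- by apply: lim_pinfty_le (wave_pinfty tw) => y; exact: travelling_le.
- by apply: le_lim_ninfty (wave_ninfty tw) => y; exact: travelling_le.
Qed.

Definition wave_energy x : R := G (p x) + F (q x).
Local Notation E := wave_energy.

Lemma is_derive_wave_energy x : is_derive x (1 : R) E (- (c * p x ^+ 2)).
Proof.
have := is_deriveD
  (is_derive_energy H wave_slope_ge0 (@wave_slope_continuous x) (is_derive_wave_flux x))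
  (@is_derive1_comp _ F q _ _ _ (dF (q x)) (is_derive_travelling x)).
rewrite (_ : p x * (f (q x) - c * p x) + f (q x) * - p x = - (c * p x ^+ 2))//.
by ring.
Qed.

Lemma wave_energy_continuous : continuous E.
Proof. by move=> x; exact: is_derive_continuous (is_derive_wave_energy x). Qed.

Lemma wave_energy_le x y : 0 <= c -> x <= y -> E y <= E x.
Proof.
move=> c0 xy; apply: (derive_le0_ge xy (fun z _ => is_derive_wave_energy z)
  (fun z _ => @wave_energy_continuous z)).
by move=> z _; rewrite oppr_le0 mulr_ge0// sqr_ge0.
Qed.

Lemma wave_energy_ge x y : c <= 0 -> x <= y -> E x <= E y.
Proof.
move=> c0 xy; apply: (derive_ge0_le xy (fun z _ => is_derive_wave_energy z)
  (fun z _ => @wave_energy_continuous z)).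
by move=> z _; rewrite oppr_ge0 mulr_le0_ge0// sqr_ge0.
Qed.

Lemma potential_lipschitz : exists2 M, 0 <= M &
  forall r s, -1 <= r <= 1 -> -1 <= s <= 1 -> `|F r - F s| <= M * `|r - s|.
Proof.
have cf := lipschitz_is_continuous (bistable_lipschitz bf).
have [m _ hm] : exists2 m, m \in `[-1, 1] & forall t, t \in `[-1, 1] ->
    `|f t| <= `|f m|.
  apply: (@EVT_max _ (fun t => `|f t|)); first by lra.
  by apply: continuous_subspaceT => r; apply: cvg_norm; exact: cf.
exists `|f m| => // r s hr hs.
wlog rs : r s hr hs / r < s => [W|].
  have [/W|/W|->] := ltgtP r s; [exact| |by rewrite !subrr normr0 mulr0].
  by rewrite distrC (distrC s); apply.
have [z /andP[rz zs] e] := mean_value rs (fun t _ => dF t)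
  (fun t _ => is_derive_continuous (dF t)).
rewrite distrC e normrM (distrC r) ler_wpM2r// hm// in_itv/=.
by move: hr hs => /andP[h1 _] /andP[_ h2]; rewrite !ltW// ?(le_lt_trans h1) ?(lt_le_trans zs).
Qed.

(** The energy is monotone, so on one of the two sides of [y] it is at least as
    large as at [y]; over a unit length on that side the slope takes its mean
    value, which the oscillation of the wave controls. *)
Lemma wave_slope_estimate : exists s M, 0 <= M /\ forall y,
  G (p y) <= G `|q (y + s) - q y| + M * `|q (y + s) - q y|.
Proof.
have [M M0 hM] := potential_lipschitz.
have [c0|/ltW c0] := leP 0 c.
- exists (- 1), M; split => // y.
  have yy : y - 1 < y by lra.
  have [x /andP[x1 x2] e] := mean_value yy (fun t _ => is_derive_travelling t)
    (fun t _ => @travelling_continuous t).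
  have px : `|q (y - 1) - q y| = p x.
    rewrite (_ : q (y - 1) - q y = p x); first by rewrite ger0_norm ?wave_slope_ge0.
    by move: e; rewrite (_ : y - (y - 1) = 1) ?mulr1; [lra|ring].
  have h1 := travelling_le (ltW x1); have h2 := travelling_le (ltW x2).
  have := wave_energy_le c0 (ltW x2); rewrite /E px => h3.
  have h4 := hM _ _ (travelling_itv x) (travelling_itv y).
  have h5 : M * `|q x - q y| <= M * p x.
    rewrite -px ler_wpM2l// !ger0_norm ?subr_ge0//; lra.
  by have := ler_norm (F (q x) - F (q y)); lra.
- exists 1, M; split => // y.
  have yy : y < y + 1 by lra.
  have [x /andP[x1 x2] e] := mean_value yy (fun t _ => is_derive_travelling t)
    (fun t _ => @travelling_continuous t).
  have px : `|q (y + 1) - q y| = p x.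
    rewrite distrC (_ : q y - q (y + 1) = p x); first by rewrite ger0_norm ?wave_slope_ge0.
    by move: e; rewrite (_ : y + 1 - y = 1) ?mulr1; [lra|ring].
  have h1 := travelling_le (ltW x1); have h2 := travelling_le (ltW x2).
  have := wave_energy_ge c0 (ltW x1); rewrite /E px => h3.
  have h4 := hM _ _ (travelling_itv x) (travelling_itv y).
  have h5 : M * `|q x - q y| <= M * p x.
    rewrite -px ler_wpM2l// !ler0_norm ?subr_le0//; lra.
  by have := ler_norm (F (q x) - F (q y)); lra.
Qed.

Lemma wave_slope_bounded : exists2 b, 0 <= b & forall x, p x <= b.
Proof.
have [s [M [M0 hM]]] := wave_slope_estimate.
have K0 : 0 <= G 2 + M * 2 by rewrite addr_ge0 ?mulr_ge0// (pair_energy_ge0 H).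
have [b b0 hb] := pair_energy_unbounded H K0.
exists b => // x; rewrite -(pair_energy_leE H) ?wave_slope_ge0//.
apply: le_trans (hM x) (le_trans _ (ltW hb)).
have h2 : `|q (x + s) - q x| <= 2.
  have /andP[? ?] := travelling_itv x; have /andP[? ?] := travelling_itv (x + s).
  by apply/ler_normlP; split; lra.
by apply: lerD; [exact: (pair_energy_mono_le H)|rewrite ler_wpM2l].
Qed.

Lemma wave_energy_cvg (FF : set_system R) (PF : ProperFilter FF) (l : R) :
  (forall s : R, q (x + s) @[x --> FF] --> l) -> E x @[x --> FF] --> F l.
Proof.
move=> ql; have [s [M [M0 hM]]] := wave_slope_estimate.
have q0 : q x @[x --> FF] --> l.
  by have := ql 0; under eq_fun do rewrite addr0.
have d0 : `|q (x + s) - q x| @[x --> FF] --> (0 : R).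
  have : `|q (x + s) - q x| @[x --> FF] --> `|l - l|.
    by apply: cvg_norm; apply: cvgB.
  by rewrite subrr normr0.
have B0 : G `|q (x + s) - q x| + M * `|q (x + s) - q x| @[x --> FF] --> (0 : R).
  have : G `|q (x + s) - q x| + M * `|q (x + s) - q x| @[x --> FF] --> G 0 + M * 0.
    apply: cvgD; last by apply: cvgM => //; exact: cvg_cst.
    apply: (@cvg_comp _ _ _ (fun x => `|q (x + s) - q x|) G); first exact: d0.
    exact: (pair_energy_continuous H).
  by rewrite (pair_energy0 H) mulr0 addr0.
have G0 : G (p x) @[x --> FF] --> (0 : R).
  apply: (squeeze_cvgr _ (cvg_cst (0 : R)) B0).
  by near=> x; rewrite (pair_energy_ge0 H) ?wave_slope_ge0//=; exact: hM.
rewrite -[F l]add0r; apply: cvgD => //.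
apply: (@cvg_comp _ _ _ q F); first exact: q0.
exact: is_derive_continuous (dF l).
Unshelve. all: by end_near. Qed.

Lemma wave_energy_ninfty : E x @[x --> -oo] --> F 1.
Proof.
apply: wave_energy_cvg => s; apply: cvg_comp (wave_ninfty tw).
exact: cvg_addrr_Ny.
Qed.

Lemma wave_energy_pinfty : E x @[x --> +oo] --> (0 : R).
Proof.
rewrite -F_left; apply: wave_energy_cvg => s; apply: cvg_comp (wave_pinfty tw).
exact: cvg_addrr.
Qed.

(** If [E] is constant and [c] is not zero, then the slope vanishes and the wave
    is constant. *)
Lemma wave_energy_nontrivial : (forall x, E x = 0) -> c = 0.
Proof.
move=> E0; apply/eqP/negP => /negP c0.
have p0 x : p x = 0.
  have := is_derive1_val (is_derive_wave_energy x).
  have -> : E = cst 0 by apply/funext => y; exact: E0.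
  rewrite derive1_cst => /esym/eqP; rewrite oppr_eq0 mulf_eq0 (negbTE c0)/=.
  by rewrite sqrf_eq0 => /eqP.
have qc x : q x = q 0.
  apply: is_derive_0_is_cst => y.
  by have := is_derive_travelling y; rewrite p0 oppr0.
have h1 : 1 <= q 0.
  by apply: lim_ninfty_le (wave_ninfty tw) => y _; rewrite qc.
have h2 : q 0 <= -1.
  by apply: le_lim_pinfty (wave_pinfty tw) => y _; rewrite qc.
by lra.
Qed.

(** If [c] were negative, [E] would be nondecreasing with limits [F 1 >= 0] and
    [0], hence zero. *)
Lemma wave_speed_ge0 : 0 <= c.
Proof.
rewrite leNgt; apply/negP => c0.
have E0 x : E x = 0.
  apply/eqP; rewrite eq_le; apply/andP; split.
  - apply: le_lim_pinfty wave_energy_pinfty => y.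
    by apply: wave_energy_ge; exact: ltW.
  - apply: le_trans F_right _; apply: lim_ninfty_le wave_energy_ninfty => y.
    by apply: wave_energy_ge; exact: ltW.
by move: c0; rewrite (wave_energy_nontrivial E0) ltxx.
Qed.

Lemma wave_energy_le_right x : E x <= F 1.
Proof.
apply: le_lim_ninfty wave_energy_ninfty => y.
by apply: wave_energy_le; exact: wave_speed_ge0.
Qed.

Lemma wave_energy_ge0 x : 0 <= E x.
Proof.
apply: lim_pinfty_le wave_energy_pinfty => y.
by apply: wave_energy_le; exact: wave_speed_ge0.
Qed.

Lemma wave_speed_eq0 : c = 0 <-> F 1 = 0.
Proof.
split=> [c0|F1].
  have Ec x : E x = E 0.
    apply: is_derive_0_is_cst => y.
    by have := is_derive_wave_energy y; rewrite c0 mul0r oppr0.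
  apply/eqP; rewrite eq_le F_right andbT.
  apply: (@le_trans _ _ (E 0)).
    by apply: lim_ninfty_le wave_energy_ninfty => y _; rewrite Ec.
  by apply: le_lim_pinfty wave_energy_pinfty => y _; rewrite [E y]Ec.
apply: wave_energy_nontrivial => x; apply/eqP; rewrite eq_le wave_energy_ge0.
by rewrite -F1 wave_energy_le_right.
Qed.

Lemma wave_speed_gt0 : 0 < c <-> 0 < F 1.
Proof.
rewrite !lt_neqAle wave_speed_ge0 F_right !andbT.
have h := wave_speed_eq0.
by split; move=> /eqP n; apply/eqP => e; apply: n; apply/esym/h.
Qed.

(** A critical point of an intermediate value would be an equilibrium, that is
    the middle zero; but there the energy would be negative. *)
Lemma wave_slope_gt0 x : -1 < q x < 1 -> 0 < p x.
Proof.
move=> hq; have := wave_slope_ge0 x; rewrite le_eqVlt => /predU1P[p0|//].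
exfalso; have dP := is_derive_wave_flux.
have d0 : is_derive x (1 : R) (fun y => psi (p y)) 0.
  apply: (@derive1_at_min _ _ (x - 1) (x + 1)).
  - by lra.
  - by move=> t _; have [] := dP t.
  - by rewrite in_itv/=; apply/andP; split; lra.
  - move=> t _; rewrite -p0 (pair_flux0 H) (pair_flux_ge0 H)//.
    exact: wave_slope_ge0.
have fq : f (q x) = 0.
  have := is_derive1_val (dP x); rewrite (is_derive1_val d0) -p0 mulr0 subr0.
  by move=> <-.
have qmu : q x = mu.
  have /andP[q0 q1] := hq; case: (ltgtP (q x) mu) => [h|h|//].
  - by have := bistable_neg bf (s := q x); rewrite q0 h fq ltxx => /(_ isT).
  - by have := bistable_pos bf (s := q x); rewrite q1 h fq ltxx => /(_ isT).
have /andP[mu0 mu1] := bistable_mu bf.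
have : F mu < F (- 1) by exact: (potential_lt dF (bistable_neg bf)).
have := wave_energy_ge0 x; rewrite /E -p0 (pair_energy0 H) qmu F_left; lra.
Qed.

Lemma wave_slope_right x : G (p x) <= F 1 - F (q x).
Proof. by have := wave_energy_le_right x; rewrite /E; lra. Qed.

(** Since [p <= b], the function [E - c * b * (q + 1)] is nondecreasing, and it
    tends to zero at infinity. *)
Lemma wave_slope_left : exists b, forall x, G (p x) <= b * (q x + 1) - F (q x).
Proof.
have [b b0 hb] := wave_slope_bounded; have c0 := wave_speed_ge0.
exists (c * b) => x.
pose Z (x : R) := E x - c * b * (q x + 1).
have dZ y : is_derive y (1 : R) Z (c * p y * (b - p y)).
  have dq1 : is_derive y (1 : R) (fun x => q x + 1) (- p y).
    have := is_deriveD (is_derive_travelling y) (is_derive_cst (1 : R) y (1 : R)).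
    by rewrite addr0.
  have := is_deriveB (is_derive_wave_energy y) (is_deriveMl (c * b) dq1).
  rewrite (_ : - (c * p y ^+ 2) - c * b * - p y = c * p y * (b - p y))//.
  by ring.
have Z0 : Z y @[y --> +oo] --> (0 : R).
  have : Z y @[y --> +oo] --> 0 - c * b * (-1 + 1).
    apply: cvgB; first exact: wave_energy_pinfty.
    apply: cvgM; first exact: cvg_cst.
    by apply: cvgD; [exact: (wave_pinfty tw)|exact: cvg_cst].
  by rewrite addNr mulr0 subr0.
have : Z x <= 0.
  apply: le_lim_pinfty Z0 => y xy.
  apply: (derive_ge0_le xy (fun t _ => dZ t) (fun t _ => is_derive_continuous (dZ t))).
  by move=> t _; rewrite !mulr_ge0 ?subr_ge0 ?wave_slope_ge0.
by rewrite /Z /E; lra.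
Qed.

(** ** The inverse of the wave *)

Lemma travelling_surj r : -1 < r < 1 -> exists x, q x = r.
Proof.
move=> /andP[r0 r1].
have [a ra] : exists a, r < q a.
  have h : \forall x \near -oo, r < q x.
    exact: (@cvgr_gt _ _ _ _ q _ (wave_ninfty tw) _ r1).
  by have [a] := @filter_ex _ _ _ _ h; exists a.
have [b rb] : exists b, q b < r.
  have h : \forall x \near +oo, q x < r.
    exact: (@cvgr_lt _ _ _ _ q _ (wave_pinfty tw) _ r0).
  by have [b] := @filter_ex _ _ _ _ h; exists b.
have ab : a <= b.
  rewrite leNgt; apply/negP => /ltW/travelling_le h.
  by have := lt_trans (lt_le_trans ra h) rb; rewrite ltxx.
have [||x _ qx] := @IVT _ q a b r ab; last by exists x.
- exact: continuous_subspaceT travelling_continuous.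
- rewrite minElt maxElt; have [qab|_] := ltP (q a) (q b).
    by have := lt_trans qab (lt_trans rb ra); rewrite ltxx.
  by rewrite !ltW.
Qed.

Definition wave_position_of r : R := xget 0 [set x | q x = r].
Local Notation X := wave_position_of.

Lemma wave_position_ofK r : -1 < r < 1 -> q (X r) = r.
Proof.
move=> /travelling_surj[x qx]; rewrite /X.
by case: xgetP => [y _ //|h]; exfalso; exact: (h x qx).
Qed.

Lemma travelling_lt x y : x < y -> -1 < q x < 1 -> q y < q x.
Proof.
move=> xy hq; have := travelling_le (ltW xy); rewrite le_eqVlt => /predU1P[e|//].
have [z /andP[xz zy] e'] := mean_value xy (fun t _ => is_derive_travelling t)
  (fun t _ => @travelling_continuous t).
have qz : q z = q x.
  apply/eqP; rewrite eq_le travelling_le ?(ltW xz)//=.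
  by rewrite -[leLHS]e travelling_le// ltW.
move: e'; rewrite e subrr => /esym/eqP; rewrite mulf_eq0 subr_eq0 (gt_eqF xy) orbF.
have := @wave_slope_gt0 z; rewrite qz => /(_ hq) pz.
by rewrite oppr_eq0 (gt_eqF pz).
Qed.

Lemma travellingK x : -1 < q x < 1 -> X (q x) = x.
Proof.
move=> hq; have e := wave_position_ofK hq.
case: (ltgtP (X (q x)) x) => // h.
- by have := travelling_lt h; rewrite e => /(_ hq); rewrite ltxx.
- by have := travelling_lt h hq; rewrite e ltxx.
Qed.

Lemma is_derive_wave_position_of r : -1 < r < 1 ->
  is_derive r (1 : R) X (- (p (X r))^-1).
Proof.
move=> hr; have e := wave_position_ofK hr.
have p0 : 0 < p (X r) by apply: wave_slope_gt0; rewrite e.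
rewrite -[r in is_derive r]e -invrN.
apply: (@is_derive_inverse _ q X (- p (X r))).
- have /andP[r0 r1] := hr.
  have h1 : \forall x \near X r, -1 < q x.
    by apply: (@cvgr_gt _ _ (nbhs (X r)) _ q _ (@travelling_continuous (X r))); rewrite e.
  have h2 : \forall x \near X r, q x < 1.
    by apply: (@cvgr_lt _ _ (nbhs (X r)) _ q _ (@travelling_continuous (X r))); rewrite e.
  near=> x; apply: travellingK; apply/andP; split; near: x; [exact: h1|exact: h2].
- by near=> x; exact: travelling_continuous.
- exact: is_derive_travelling.
- by rewrite oppr_eq0 gt_eqF.
Unshelve. all: by end_near. Qed.

Lemma wave_profile_gt0 r : -1 < r < 1 -> 0 < p (X r).
Proof. by move=> hr; apply: wave_slope_gt0; rewrite wave_position_ofK. Qed.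

Lemma wave_profile_ode r : -1 < r < 1 ->
  is_derive r (1 : R) (fun r => psi (p (X r))) (c - f r / p (X r)).
Proof.
move=> hr; have p0 := wave_profile_gt0 hr.
have := @is_derive1_comp _ (fun y => psi (p y)) X _ _ _
  (is_derive_wave_flux (X r)) (is_derive_wave_position_of hr).
rewrite wave_position_ofK//.
rewrite (_ : (f r - c * p (X r)) * - (p (X r))^-1 = c - f r / p (X r))//.
by field; rewrite gt_eqF.
Qed.

Lemma flux_squeeze (FF : set_system R) (PF : ProperFilter FF) (b : R -> R) :
  (\forall r \near FF, -1 < r < 1) -> b r @[r --> FF] --> (0 : R) ->
  (forall r, -1 < r < 1 -> G (p (X r)) <= b r) ->
  psi (p (X r)) @[r --> FF] --> (0 : R).
Proof.
move=> hF b0 hb.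
have G0 : G (p (X r)) @[r --> FF] --> (0 : R).
  apply: (squeeze_cvgr _ (cvg_cst (0 : R)) b0).
  near=> r; rewrite (pair_energy_ge0 H) ?wave_slope_ge0//= hb//.
  by near: r.
have p0 : p (X r) @[r --> FF] --> (0 : R).
  apply/cvgr0Pnorm_lt => e e0.
  have Ge := pair_energy_gt0 H e0.
  have : \forall r \near FF, G (p (X r)) < G e.
    exact: (@cvgr_lt _ _ FF _ _ _ G0 _ Ge).
  apply: filterS => r; rewrite (pair_energy_ltE H) ?wave_slope_ge0 ?ltW//.
  by rewrite ger0_norm ?wave_slope_ge0.
rewrite -(pair_flux0 H); apply: (@cvg_comp _ _ _ (fun r => p (X r)) psi).
  exact: p0.
exact: (pair_flux_continuous H).
Unshelve. all: by end_near. Qed.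

Lemma wave_profile_left : psi (p (X r)) @[r --> (-1 : R)^'+] --> (0 : R).
Proof.
have [b hb] := wave_slope_left.
apply: (@flux_squeeze _ _ (fun r => b * (r + 1) - F r)).
- near=> r; apply/andP; split; near: r; first exact: nbhs_right_gt.
  by apply: nbhs_right_lt; lra.
- have : b * (r + 1) - F r @[r --> (-1 : R)^'+] --> b * (-1 + 1) - F (-1).
    apply: cvg_at_right_filter; apply: cvgB.
      apply: cvgM; first exact: cvg_cst.
      by apply: cvgD; [exact: cvg_id|exact: cvg_cst].
    exact: is_derive_continuous (dF (-1)).
  by rewrite addNr mulr0 F_left subr0.
- by move=> r hr; have := hb (X r); rewrite wave_position_ofK.
Unshelve. all: by end_near. Qed.

Lemma wave_profile_right : psi (p (X r)) @[r --> (1 : R)^'-] --> (0 : R).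
Proof.
apply: (@flux_squeeze _ _ (fun r => F 1 - F r)).
- near=> r; apply/andP; split; near: r; last exact: nbhs_left_lt.
  by apply: nbhs_left_gt; lra.
- have : F 1 - F r @[r --> (1 : R)^'-] --> F 1 - F 1.
    apply: cvg_at_left_filter; apply: cvgB; first exact: cvg_cst.
    exact: is_derive_continuous (dF 1).
  by rewrite subrr.
- by move=> r hr; have := wave_slope_right (X r); rewrite wave_position_ofK.
Unshelve. all: by end_near. Qed.

End OneWave.

End WaveAnalysis.

(** * Comparison of profiles and uniqueness *)

Section Comparison.
Variables (R : realType) (f G psi : R -> R) (lam mu : R).
Hypothesis bf : bistable f mu.
Hypothesis H : legendre_pair psi G lam.
Implicit Types (r : R) (p : R -> R) (c : R).

(** On [(-1, mu)] the right-hand side [c - f / p] of the profile equation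
    decreases with the flux and on [(mu, 1)] it increases. *)
Lemma profile_compare p1 p2 c1 c2 :
  (forall r, -1 < r < 1 -> 0 < p1 r) -> (forall r, -1 < r < 1 -> 0 < p2 r) ->
  (forall r, -1 < r < 1 ->
    is_derive r (1 : R) (fun r => psi (p1 r)) (c1 - f r / p1 r)) ->
  (forall r, -1 < r < 1 ->
    is_derive r (1 : R) (fun r => psi (p2 r)) (c2 - f r / p2 r)) ->
  psi (p1 r) @[r --> (-1 : R)^'+] --> (0 : R) ->
  psi (p2 r) @[r --> (-1 : R)^'+] --> (0 : R) ->
  psi (p1 r) @[r --> (1 : R)^'-] --> (0 : R) ->
  psi (p2 r) @[r --> (1 : R)^'-] --> (0 : R) ->
  c1 <= c2 ->
  [/\ forall r, -1 < r <= mu -> p1 r <= p2 r,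
      forall r, mu <= r < 1 -> p2 r <= p1 r & c1 = c2].
Proof.
move=> p1_gt0 p2_gt0 d1 d2 l1 l2 r1 r2 c12.
have /andP[mu0 mu1] := bistable_mu bf.
have [_ fmu _] := bistable_zeros bf.
pose D r := psi (p2 r) - psi (p1 r).
have dD r : -1 < r < 1 ->
    is_derive r (1 : R) D (c2 - c1 - f r * ((p2 r)^-1 - (p1 r)^-1)).
  move=> hr; have := is_deriveB (d2 r hr) (d1 r hr).
  rewrite (_ : c2 - f r / p2 r - (c1 - f r / p1 r) =
    c2 - c1 - f r * ((p2 r)^-1 - (p1 r)^-1))//; ring.
have D_lt0 r : -1 < r < 1 -> (D r < 0) = (p2 r < p1 r).
  by move=> hr; rewrite subr_lt0 (pair_flux_ltE H) ?ltW ?p1_gt0 ?p2_gt0.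
have D_gt0 r : -1 < r < 1 -> (0 < D r) = (p1 r < p2 r).
  by move=> hr; rewrite subr_gt0 (pair_flux_ltE H) ?ltW ?p1_gt0 ?p2_gt0.
have left r : -1 < r <= mu -> p1 r <= p2 r.
  move=> /andP[r0 rm]; have hr : -1 < r < 1 by rewrite r0 (le_lt_trans rm).
  rewrite leNgt -D_lt0//; apply/negP => Dr.
  have Dl : D a @[a --> (-1 : R)^'+] --> (0 : R).
    by have := cvgB l2 l1; rewrite subr0; exact.
  suff : 0 <= D r by rewrite leNgt Dr.
  apply: ler_cvg_to Dl (cvg_cst (D r)) _; near=> a.
  have a0 : -1 < a by near: a; exact: nbhs_right_gt.
  have ar : a <= r by near: a; exact: nbhs_right_le.
  apply: (neg_part_le ar _ _ Dr (dD := fun r => c2 - c1 - f r * ((p2 r)^-1 - (p1 r)^-1))).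
  - by move=> x /andP[ax xr]; apply: dD; rewrite (lt_le_trans a0 ax) (le_lt_trans xr)//; case/andP: hr.
  - move=> x /andP[ax xr]; have x0 := lt_le_trans a0 ax; have xm := le_trans xr rm.
    have hx : -1 < x < 1 by rewrite x0 (le_lt_trans xm).
    rewrite D_lt0// => px.
    have fx : f x <= 0.
      move: xm; rewrite le_eqVlt => /predU1P[->|xm]; first by rewrite fmu.
      by apply/ltW/(bistable_neg bf); rewrite x0.
    rewrite addr_ge0 ?subr_ge0// oppr_ge0 mulr_le0_ge0// subr_ge0.
    by rewrite lef_pV2 ?posrE ?p1_gt0 ?p2_gt0// ltW.
have right r : mu <= r < 1 -> p2 r <= p1 r.
  move=> /andP[mr rlt1]; have hr : -1 < r < 1 by rewrite rlt1 (lt_le_trans mu0).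
  rewrite leNgt -D_gt0//; apply/negP => Dr.
  have Dl : D b @[b --> (1 : R)^'-] --> (0 : R).
    by have := cvgB r2 r1; rewrite subr0; exact.
  suff : D r <= 0 by rewrite leNgt Dr.
  apply: ler_cvg_to (cvg_cst (D r)) Dl _; near=> b.
  have b1 : b < 1 by near: b; exact: nbhs_left_lt.
  have rb : r <= b by near: b; exact: nbhs_left_ge.
  apply: (pos_part_le rb _ _ Dr (dD := fun r => c2 - c1 - f r * ((p2 r)^-1 - (p1 r)^-1))).
  - by move=> x /andP[rx xb]; apply: dD; rewrite (le_lt_trans xb b1) (lt_le_trans _ rx)//; case/andP: hr.
  - move=> x /andP[rx xb]; have x1 := le_lt_trans xb b1; have mx := le_trans mr rx.
    have hx : -1 < x < 1 by rewrite x1 (lt_le_trans mu0).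
    rewrite D_gt0// => px.
    have fx : 0 <= f x.
      move: mx; rewrite le_eqVlt => /predU1P[<-|mx]; first by rewrite fmu.
      by apply/ltW/(bistable_pos bf); rewrite mx.
    rewrite addr_ge0 ?subr_ge0// oppr_ge0 mulr_ge0_le0// subr_le0.
    by rewrite lef_pV2 ?posrE ?p1_gt0 ?p2_gt0// ltW.
split => //; apply/eqP; rewrite eq_le c12 leNgt; apply/negP => c21.
have hmu : -1 < mu < 1 by rewrite mu0.
have pmu : p1 mu = p2 mu.
  by apply/eqP; rewrite eq_le left ?right ?mu0 ?mu1 ?lexx.
have dN := is_deriveN (dD mu hmu).
have dlt : - (c2 - c1 - f mu * ((p2 mu)^-1 - (p1 mu)^-1)) < 0.
  by rewrite fmu mul0r subr0 oppr_lt0 subr_gt0.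
have [y /andP[my y1]] := @is_derive_lt_right _ (fun r => - D r) mu _ 1 dN dlt mu1.
rewrite /D pmu subrr oppr0 oppr_lt0 -/(D y) D_gt0; last by rewrite y1 (lt_trans mu0).
by rewrite ltNge right// y1 ltW.
Unshelve. all: by end_near. Qed.

End Comparison.

Theorem travelling_wave_unique (R : realType) (f F G Phi : R -> R) (lam mu : R)
    (q1 q2 : R -> R) (c1 c2 : R) :
  bistable f mu -> (forall r : R, is_derive r (1 : R) F (f r)) ->
  F (- 1) = 0 -> 0 <= F 1 -> legendre_pair (derive1 Phi) G lam ->
  travelling_wave f Phi mu q1 c1 -> travelling_wave f Phi mu q2 c2 ->
  c1 = c2 /\ q1 = q2.
Proof.
move=> bf dF F0 F1 H tw1 tw2.
wlog c12 : q1 q2 c1 c2 tw1 tw2 / c1 <= c2.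
  move=> W; have [c12|/ltW c21] := leP c1 c2; first exact: W.
  by have [-> ->] := W _ _ _ _ tw2 tw1 c21.
pose X1 := wave_position_of q1; pose X2 := wave_position_of q2.
have gt1 := wave_profile_gt0 bf dF F0 F1 H tw1.
have gt2 := wave_profile_gt0 bf dF F0 F1 H tw2.
have ode1 := wave_profile_ode bf dF F0 F1 H tw1.
have ode2 := wave_profile_ode bf dF F0 F1 H tw2.
have l1 := wave_profile_left bf dF F0 F1 H tw1.
have l2 := wave_profile_left bf dF F0 F1 H tw2.
have r1 := wave_profile_right bf dF F0 F1 H tw1.
have r2 := wave_profile_right bf dF F0 F1 H tw2.
have [h1 h2 ce] := profile_compare bf H gt1 gt2 ode1 ode2 l1 l2 r1 r2 c12.
have c21 : c2 <= c1 by rewrite ce.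
have [h3 h4 _] := profile_compare bf H gt2 gt1 ode2 ode1 l2 l1 r2 r1 c21.
split => //.
have pe (r : R) : -1 < r < 1 -> wave_slope q1 (X1 r) = wave_slope q2 (X2 r).
  move=> /andP[r0 rlt]; apply/eqP; rewrite eq_le.
  have [rm|/ltW mr] := leP r mu.
  - by rewrite h1 ?h3 ?r0.
  - by rewrite h2 ?h4 ?mr.
have /andP[mu0 mu1] := bistable_mu bf.
have hmu : -1 < mu < 1 by rewrite mu0.
have X1m : X1 mu = 0.
  rewrite -(wave_center tw1); apply: (travellingK bf dF F0 F1 H tw1).
  by rewrite (wave_center tw1).
have X2m : X2 mu = 0.
  rewrite -(wave_center tw2); apply: (travellingK bf dF F0 F1 H tw2).
  by rewrite (wave_center tw2).
have dX (r : R) : -1 < r < 1 -> is_derive r (1 : R) (fun r => X1 r - X2 r) 0.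
  move=> hr; have := is_deriveB (is_derive_wave_position_of bf dF F0 F1 H tw1 hr)
    (is_derive_wave_position_of bf dF F0 F1 H tw2 hr).
  by rewrite pe// subrr.
have Xe (r : R) : -1 < r < 1 -> X1 r = X2 r.
  move=> /andP[r0 rlt]; apply/eqP; rewrite -subr_eq0; apply/eqP.
  have cont (a b x : R) : -1 < a -> b < 1 -> a <= x <= b ->
      {for x, continuous (fun r => X1 r - X2 r)}.
    move=> a0 b1 /andP[ax xb]; apply: is_derive_continuous (dX x _).
    by rewrite (lt_le_trans a0 ax) (le_lt_trans xb b1).
  have der (a b x : R) : -1 < a -> b < 1 -> a < x < b ->
      is_derive x (1 : R) (fun r => X1 r - X2 r) 0.
    move=> a0 b1 /andP[ax xb]; apply: dX.
    by rewrite (lt_trans a0 ax) (lt_trans xb b1).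
  case: (ltgtP mu r) => [mr|rm|<-]; last by rewrite X1m X2m subrr.
  - have [z _] := mean_value mr (fun x => der _ _ x mu0 rlt) (fun x => cont _ _ x mu0 rlt).
    by rewrite mul0r X1m X2m subrr subr0.
  - have [z _] := mean_value rm (fun x => der _ _ x r0 mu1) (fun x => cont _ _ x r0 mu1).
    by rewrite mul0r X1m X2m subrr sub0r => /eqP; rewrite oppr_eq0 => /eqP.
have i1 := travelling_itv tw1; have i2 := travelling_itv tw2.
apply/funext => x.
have [hq1|hq1] := boolP (-1 < q1 x < 1).
  have := travellingK bf dF F0 F1 H tw1 hq1; rewrite -/X1 Xe// => <-.
  rewrite (wave_position_ofK tw2 hq1).
  by rewrite -[X2 _]Xe// /X1 (wave_position_ofK tw1 hq1).
have [hq2|hq2] := boolP (-1 < q2 x < 1).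
  have := travellingK bf dF F0 F1 H tw2 hq2; rewrite -/X2 -Xe// => <-.
  rewrite (wave_position_ofK tw1 hq2).
  by rewrite [X1 _]Xe// /X2 (wave_position_ofK tw2 hq2).
have [x0|/ltW x0] := leP x 0.
- have e q c : travelling_wave f Phi mu q c -> ~~ (-1 < q x < 1) -> q x = 1.
    move=> tw; have := travelling_le tw x0; rewrite (wave_center tw) => h.
    have /andP[_ q1'] := travelling_itv tw x.
    rewrite (lt_le_trans mu0 h)/= -leNgt => h'.
    by apply/eqP; rewrite eq_le q1'.
  by rewrite (e _ _ tw1)// (e _ _ tw2).
- have e q c : travelling_wave f Phi mu q c -> ~~ (-1 < q x < 1) -> q x = -1.
    move=> tw; have := travelling_le tw x0; rewrite (wave_center tw) => h.
    have /andP[q1' _] := travelling_itv tw x.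
    rewrite (le_lt_trans h mu1) andbT -leNgt => h'.
    by apply/eqP; rewrite eq_le q1' h'.
  by rewrite (e _ _ tw1)// (e _ _ tw2).
Qed.

(** * Integrals over the line and the theorem *)

(** The half-lines are treated separately, the left one after a reflection. *)
Lemma ge0_integralT_derive (R : realType) (u g : R -> R) (a b : R) :
  (forall x, 0 <= g x) -> continuous g ->
  (forall x : R, is_derive x (1 : R) u (g x)) ->
  u x @[x --> -oo] --> a -> u x @[x --> +oo] --> b ->
  (\int[lebesgue_measure]_x (g x)%:E = (b - a)%:E)%E.
Proof.
move=> g0 cg du ua ub.
have cu : continuous u by move=> x; exact: is_derive_continuous (du x).
have mg : measurable_fun [set: R] g by exact: continuous_measurable_fun.
have right : (\int[lebesgue_measure]_(x in `[0%R, +oo[) (g x)%:E = b%:E - (u 0)%:E)%E.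
  apply: (@ge0_continuous_FTC2y R g u 0 b (fun x _ => g0 x)
    (continuous_subspaceT cg) ub (fun x _ => @ex_derive _ _ _ _ _ _ _ (du x))).
    by apply: cvg_at_right_filter; exact: cu.
  by move=> x _; exact: is_derive1_val.
have left : (\int[lebesgue_measure]_(x in `]-oo, 0%R]) (g x)%:E = (u 0)%:E - a%:E)%E.
  rewrite -[X in `]-oo, X]]oppr0 ge0_integration_by_substitutionNy; last 2 first.
  - exact: continuous_subspaceT.
  - by move=> x _; exact: g0.
  have dv x : is_derive x (1 : R) (fun x => - u (- x)) (g (- x)).
    have := is_deriveN (@is_derive1_comp _ u -%R _ _ _ (du (- x)) (is_deriveNid x (1 : R))).
    by rewrite mulrN1 opprK.
  have cgN : continuous (fun x => g (- x)).
    move=> x; apply: (@cvg_comp _ _ _ -%R g); last exact: cg.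
    by apply: cvgN; exact: cvg_id.
  have va : - u (- x) @[x --> +oo] --> - a.
    by apply: cvgN; apply: cvg_comp ua; exact/cvgNrNy.
  have v0 : - u (- x) @[x --> (0 : R)^'+] --> - u (- 0).
    by apply: cvg_at_right_filter; exact: is_derive_continuous (dv 0).
  rewrite (@ge0_continuous_FTC2y R (g \o -%R) (fun x => - u (- x)) 0 (- a)
    (fun x _ => g0 (- x)) (continuous_subspaceT cgN) va
    (fun x _ => @ex_derive _ _ _ _ _ _ _ (dv x)) v0
    (fun x _ => is_derive1_val (dv x))).
  by rewrite oppr0 -!EFinB; congr EFin; ring.
rewrite -(setUv `]-oo, 0%R]%classic) setCitvl ge0_integral_setU//=.
- rewrite left integral_itv_obnd_cbnd//.
    by rewrite right -!EFinB -EFinD; congr EFin; ring.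
  by apply/measurable_EFinP; exact: measurable_funS mg.
- by apply/measurable_EFinP; exact: measurable_funS mg.
- by move=> x _; rewrite lee_fin.
- rewrite -setCitvl; apply/disj_setPS; by rewrite setICr.
Qed.

Lemma bounded_Lfun_infty (R : realType) (g : R -> R) (b : R) :
  measurable_fun setT g -> (forall x, `|g x| <= b) ->
  g \in Lfun lebesgue_measure +oo%E.
Proof.
move=> mg gb; rewrite inE; apply/andP; split; rewrite inE//=.
rewrite /finite_norm unlock /Lnorm; case: ifP => // _.
apply: (@le_lt_trans _ _ b%:E); last exact: ltry.
by apply/ess_supP; apply/nearW => x; rewrite /= lee_fin.
Qed.

Theorem proposition3p1 (R : realType) (f phi Phi : R -> R) (mu : R)
    (hf : bistable f mu) (hPhi : admissible_energy phi Phi) :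
  (exists! qc : (R -> R) * R, travelling_wave f Phi mu qc.1 qc.2) /\
  (forall (q : R -> R) (c : R), travelling_wave f Phi mu q c ->
    [/\ derive1 q \in Lfun lebesgue_measure 1,
        derive1 q \in Lfun lebesgue_measure +oo%E,
        forall x : R, -1 < q x < 1 -> derive1 q x < 0,
        c = (\int[lebesgue_measure]_x (`|derive1 q x| ^+ 2))^-1
            * \int[lebesgue_measure]_(s in `[-1, 1]) f s
          /\ 0 <= c
      & 0 < c <-> 0 < primitive f 1]).
Proof.
have [F [dF F0 FE F1]] := bistable_potential hf.
have [lam H] := admissible_legendre_pair hPhi.
split.
  have [q [c tw]] := travelling_wave_exists hf hPhi.
  exists (q, c); split => // -[q' c'] /= tw'.
  by have [-> ->] := travelling_wave_unique hf dF F0 F1 H tw tw'.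
move=> q c tw.
have pF : \int[lebesgue_measure]_(s in `[-1, 1]) f s = F 1.
  by rewrite -FE//; lra.
have cq : continuous (derive1 q).
  by move=> x; have [] := wave_C1 tw (x := x) I.
have mq : measurable_fun [set: R] (derive1 q) by exact: continuous_measurable_fun.
have absq x : `|derive1 q x| = wave_slope q x.
  by rewrite ler0_norm//; exact: (wave_le0 tw).
have cp := wave_slope_continuous tw.
have c0 := wave_speed_ge0 hf dF F0 F1 H tw.
split.
- rewrite inE; apply/andP; split; rewrite inE//=.
  rewrite /finite_norm Lnorm1.
  under eq_integral do rewrite /= absq.
  (* The integral of the slope is the total drop [2] of the wave. *)
  have dq x : is_derive x (1 : R) (fun x => - q x) (wave_slope q x).
    by have := is_deriveN (is_derive_travelling tw x); rewrite opprK.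
  have qN : - q x @[x --> -oo] --> (-1 : R) by apply: cvgN; exact: (wave_ninfty tw).
  have qy : - q x @[x --> +oo] --> - (-1 : R) by apply: cvgN; exact: (wave_pinfty tw).
  by rewrite (ge0_integralT_derive (wave_slope_ge0 tw) cp dq qN qy) ltry.
- have [b b0 hb] := wave_slope_bounded hf dF H tw.
  by apply: (@bounded_Lfun_infty _ _ b) => // x; rewrite absq.
- move=> x /(wave_slope_gt0 hf dF F0 F1 H tw).
  by rewrite /wave_slope oppr_gt0.
- split => //; rewrite pF.
  have := c0; rewrite le_eqVlt => /predU1P[c0'|cpos].
    have [F10 _] := wave_speed_eq0 hf dF F0 F1 H tw.
    by rewrite (F10 (esym c0')) mulr0 -c0'.
  have F1pos : 0 < F 1 by apply/(wave_speed_gt0 hf dF F0 F1 H tw).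
  have -> : \int[lebesgue_measure]_x (`|derive1 q x| ^+ 2) = F 1 / c.
    rewrite /Rintegral; under eq_integral do rewrite absq.
    (* The energy decreases from [F 1] to [0] at the rate [c * p^2]. *)
    pose E := wave_energy F (fun z => z * derive1 Phi z - Phi z) q.
    have dE x : is_derive x (1 : R) (fun x => - c^-1 * E x) (wave_slope q x ^+ 2).
      have := is_deriveMl (- c^-1) (is_derive_wave_energy dF H tw x).
      rewrite (_ : - c^-1 * - (c * wave_slope q x ^+ 2) = wave_slope q x ^+ 2)//.
      by field; rewrite gt_eqF.
    have EN : - c^-1 * E x @[x --> -oo] --> - c^-1 * F 1.
      by apply: cvgM; [exact: cvg_cst|exact: (wave_energy_ninfty hf dF H tw)].
    have Ey : - c^-1 * E x @[x --> +oo] --> - c^-1 * (0 : R).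
      by apply: cvgM; [exact: cvg_cst|exact: (wave_energy_pinfty hf dF F0 H tw)].
    have cp2 : continuous (fun x => wave_slope q x ^+ 2).
      by move=> x; apply: cvgM; exact: cp.
    rewrite (ge0_integralT_derive (fun x => sqr_ge0 (wave_slope q x)) cp2 dE EN Ey).
    by rewrite /=; field; rewrite gt_eqF.
  by field; rewrite !gt_eqF.
- rewrite FE; last by lra.
  exact: (wave_speed_gt0 hf dF F0 F1 H tw).
Qed.
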